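(* Let $(X,A_1,\dots,A_n)$ satisfy condition $( * )$ and suppose $X$ is simply connected. Let $p:X\to X/(A_1,\dots,A_n)$ be the quotient map, $a\in\bigcup_{i=1}^nA_i$ and $*=p(a)$. Then $\pi_1^{top}(X/(A_1,\dots,A_n),* )$ is an indiscrete topological group (its only open sets are the empty set and the whole group).
   Context: $X/(A_1,\dots,A_n)$ denotes the quotient space of $X$ by the equivalence relation generated by identifying all points of $A_i$ with each other for each $i$, with quotient map $p$. $\pi_1^{top}(Y,y)$ is $\pi_1(Y,y)$ with the quotient topology with respect to the canonical surjection from the loop space $\Omega(Y,y)$ (based loops with the compact-open topology). Condition $( * )$ on $(X,A_1,\dots,A_n)$ means one of: (i) $X$ is path connected and the $A_i$ are open subsets of $X$ whose closures are path connected; or (ii) $X$ is connected, locally path connected and first countable, and each $A_i$ is an open or closed subset of $X$, the closures $\overline{A_i}$ being path connected and pairwise disjoint. *)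

(* Defs.v *)
From Stdlib Require Import Reals Relations List.
Open Scope R_scope.


Record topology (T : Type) := Topology {
  is_open : (T -> Prop) -> Prop;
  open_full : is_open (fun _ => True);
  open_inter : forall U V, is_open U -> is_open V -> is_open (fun x => U x /\ V x);
  open_union : forall (J : Type) (F : J -> T -> Prop),
      (forall j, is_open (F j)) -> is_open (fun x => exists j, F j x) }.
Arguments is_open {T} t _.

Inductive gen_open {T : Type} (S : (T -> Prop) -> Prop) : (T -> Prop) -> Prop :=
| go_sub : forall U, S U -> gen_open S U
| go_full : gen_open S (fun _ => True)
| go_inter : forall U V, gen_open S U -> gen_open S V -> gen_open S (fun x => U x /\ V x)
| go_union : forall (J : Type) (F : J -> T -> Prop),
    (forall j, gen_open S (F j)) -> gen_open S (fun x => exists j, F j x).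

Definition generated_topology {T : Type} (S : (T -> Prop) -> Prop) : topology T :=
  @Topology T (gen_open S) (go_full S) (@go_inter T S) (@go_union T S).

Definition R_top : topology R :=
  generated_topology (fun U => exists x eps, 0 < eps /\
                         forall y, U y <-> Rabs (y - x) < eps).

Definition subspace_topology {X : Type} (TX : topology X) (P : X -> Prop)
  : topology {x : X | P x} :=
  generated_topology (fun V => exists U, is_open TX U /\
                         forall z, V z <-> U (proj1_sig z)).

Definition product_topology {X Y : Type} (TX : topology X) (TY : topology Y)
  : topology (X * Y) :=
  generated_topology (fun V => exists U W, is_open TX U /\ is_open TY W /\
                         forall z, V z <-> (U (fst z) /\ W (snd z))).

Definition quot {X : Type} (Rel : X -> X -> Prop) : Type :=
  {S : X -> Prop | exists x, S = Rel x}.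
Definition qmap {X : Type} (Rel : X -> X -> Prop) (x : X) : quot Rel :=
  exist _ (Rel x) (ex_intro _ x eq_refl).

Definition quotient_topology {X : Type} (TX : topology X) (Rel : X -> X -> Prop)
  : topology (quot Rel).
Proof.
  refine (@Topology (quot Rel) (fun V => is_open TX (fun x => V (qmap Rel x))) _ _ _).
  - exact (open_full _ TX).
  - intros U V HU HV; exact (open_inter _ TX _ _ HU HV).
  - intros J F HF; exact (open_union _ TX _ (fun j x => F j (qmap Rel x)) HF).
Defined.

Definition continuous {X Y : Type} (TX : topology X) (TY : topology Y) (f : X -> Y) :=
  forall V, is_open TY V -> is_open TX (fun x => V (f x)).

Definition compact {X : Type} (TX : topology X) (K : X -> Prop) :=
  forall (J : Type) (F : J -> X -> Prop), (forall j, is_open TX (F j)) ->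
    (forall x, K x -> exists j, F j x) ->
    exists l : list J, forall x, K x -> exists j, In j l /\ F j x.

Definition closed {X : Type} (TX : topology X) (C : X -> Prop) :=
  is_open TX (fun x => ~ C x).

Definition closure {X : Type} (TX : topology X) (A : X -> Prop) (x : X) : Prop :=
  forall C, closed TX C -> (forall y, A y -> C y) -> C x.

Definition I := {t : R | 0 <= t <= 1}.
Definition I0 : I := exist _ 0 (conj (Rle_refl 0) Rle_0_1).
Definition I1 : I := exist _ 1 (conj Rle_0_1 (Rle_refl 1)).
Definition I_top : topology I := subspace_topology R_top (fun t => 0 <= t <= 1).

Definition path_connected_set {X : Type} (TX : topology X) (A : X -> Prop) :=
  forall x y, A x -> A y -> exists g : I -> X,
    continuous I_top TX g /\ g I0 = x /\ g I1 = y /\ forall t, A (g t).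

Definition path_connected {X : Type} (TX : topology X) :=
  path_connected_set TX (fun _ => True).

Definition connected {X : Type} (TX : topology X) :=
  forall U V, is_open TX U -> is_open TX V -> (forall x, U x \/ V x) ->
    (forall x, ~ (U x /\ V x)) -> (exists x, U x) -> (exists x, V x) -> False.

Definition locally_path_connected {X : Type} (TX : topology X) :=
  forall x U, is_open TX U -> U x -> exists V, is_open TX V /\ V x /\
    (forall y, V y -> U y) /\ path_connected_set TX V.

Definition first_countable {X : Type} (TX : topology X) :=
  forall x, exists B : nat -> X -> Prop, (forall k, is_open TX (B k) /\ B k x) /\
    forall U, is_open TX U -> U x -> exists k, forall y, B k y -> U y.

Definition loop_homotopic {Y : Type} (TY : topology Y) (y : Y) (f g : I -> Y) :=
  exists H : I * I -> Y, continuous (product_topology I_top I_top) TY H /\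
    forall s t, H (s, I0) = f s /\ H (s, I1) = g s /\ H (I0, t) = y /\ H (I1, t) = y.

Definition simply_connected {X : Type} (TX : topology X) :=
  path_connected TX /\
  forall x (f : I -> X), continuous I_top TX f -> f I0 = x -> f I1 = x ->
    loop_homotopic TX x f (fun _ => x).

Definition loops {Y : Type} (TY : topology Y) (y : Y) : Type :=
  {f : I -> Y | continuous I_top TY f /\ f I0 = y /\ f I1 = y}.

Definition loop_space_topology {Y : Type} (TY : topology Y) (y : Y)
  : topology (loops TY y) :=
  generated_topology (fun V => exists K U, compact I_top K /\ is_open TY U /\
     forall f : loops TY y, V f <-> forall t, K t -> U (proj1_sig f t)).

Definition pi1_rel {Y : Type} (TY : topology Y) (y : Y) (f g : loops TY y) : Prop :=
  loop_homotopic TY y (proj1_sig f) (proj1_sig g).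

Definition pi1 {Y : Type} (TY : topology Y) (y : Y) : Type := quot (pi1_rel TY y).

Definition pi1_top {Y : Type} (TY : topology Y) (y : Y) : topology (pi1 TY y) :=
  quotient_topology (loop_space_topology TY y) (pi1_rel TY y).

Definition indiscrete {T : Type} (TT : topology T) :=
  forall U, is_open TT U -> (forall x, ~ U x) \/ (forall x, U x).

Definition ident_rel {X : Type} (n : nat) (A : nat -> X -> Prop) : X -> X -> Prop :=
  clos_refl_sym_trans X (fun x y => exists i, (i < n)%nat /\ A i x /\ A i y).

Definition condition_star {X : Type} (TX : topology X) (n : nat) (A : nat -> X -> Prop) :=
  (path_connected TX /\
     forall i, (i < n)%nat -> is_open TX (A i) /\ path_connected_set TX (closure TX (A i)))
  \/
  (connected TX /\ locally_path_connected TX /\ first_countable TX /\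
     (forall i, (i < n)%nat -> (is_open TX (A i) \/ closed TX (A i)) /\
                             path_connected_set TX (closure TX (A i))) /\
     (forall i j, (i < n)%nat -> (j < n)%nat -> i <> j ->
        forall x, ~ (closure TX (A i) x /\ closure TX (A j) x))).

(* Main.v *)
From Stdlib Require Import Reals Relations List Lra Lia Classical ClassicalEpsilon
  FunctionalExtensionality PropExtensionality.
Require Import Defs.
Local Open Scope R_scope.

(* Write [p] for the quotient map.  A path between two points of
   a fibre of [p] may be chosen in the closures of the [A i], and its image is null-homotopic
   since [p (A i)] is dense in [p (closure (A i))].  Hence pieces of paths of X can be
   concatenated whenever their images match, and every loop of the quotient is, in the
   compact-open topology, a limit of loops homotopic to images of loops of X.  The latter are
   null-homotopic as X is simply connected, so every neighbourhood of the class of a loop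
   contains the trivial class; applied to the second half of [f] followed by its inverse,
   the same argument shows that every neighbourhood of the trivial class contains [f]. *)

(** Paths of the quotient need not lift to X, so lifting is weakened to the relation [linked]: two
    points are joined by a path of X whose image is homotopic, with fixed ends, to a path inside a
    given open set [U]. The image itself may leave [U], and this freedom is what lets all points of
    one fibre be linked inside every neighbourhood of their common image. The condition on the [A i]
    enters through [locally_linked], and its two alternatives call for different arguments. With
    disjoint closures, local path connectedness yields a saturated open set around a fibre, made of
    points linked to that fibre. With open sets whose closures may meet, small neighbourhoods in X
    need not be path connected; there the stretches of a path that avoid the [A i] lift by
    themselves, and the finiteness of the family controls how the path approaches the points
    [p (A i)]. Only the second half of a loop is ever replaced; the first half is left free to carry
    an arbitrary loop, and this is why one truncation lemma serves both halves of the argument. *)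

Ltac case_minmax :=
  unfold Rmax, Rmin, Rabs in *;
  repeat match goal with
    | |- context [Rle_dec ?a ?b] => destruct (Rle_dec a b)
    | |- context [Rcase_abs ?a] => destruct (Rcase_abs a)
    | H : context [Rle_dec ?a ?b] |- _ => destruct (Rle_dec a b)
    | H : context [Rcase_abs ?a] |- _ => destruct (Rcase_abs a)
    end; try lra.

(** * Topologies *)

Lemma open_ext {T : Type} (TT : topology T) (U V : T -> Prop) :
  is_open TT U -> (forall x, U x <-> V x) -> is_open TT V.
Proof.
  intros HU HE.
  replace V with U; auto.
  apply functional_extensionality; intro x; apply propositional_extensionality; auto.
Qed.

Lemma open_of_nbhd {T : Type} (TT : topology T) (V : T -> Prop) :
  (forall x, V x -> exists U, is_open TT U /\ U x /\ forall z, U z -> V z) ->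
  is_open TT V.
Proof.
  intros H.
  apply open_ext with (fun x => exists j : {U | is_open TT U /\ forall z, U z -> V z},
                           proj1_sig j x).
  - apply open_union. intros [U HU]; simpl; tauto.
  - intros x; split.
    + intros [[U HU] Hx]; simpl in Hx. now apply HU.
    + intros Hx. destruct (H x Hx) as (U & H1 & H2 & H3).
      now exists (exist _ U (conj H1 H3)).
Qed.

Lemma open_imp {T : Type} (TT : topology T) (P : Prop) (U : T -> Prop) :
  is_open TT U -> is_open TT (fun x => P -> U x).
Proof.
  intros HU. destruct (classic P) as [HP|HP].
  - apply open_ext with U; tauto.
  - apply open_ext with (fun _ => True); [apply open_full | tauto].
Qed.

Lemma nbhd_finite_inter {T : Type} (TT : topology T) (x : T) (Q : nat -> T -> Prop) (n : nat) :
  (forall i, (i < n)%nat -> exists V, is_open TT V /\ V x /\ forall z, V z -> Q i z) ->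
  exists V, is_open TT V /\ V x /\ forall z, V z -> forall i, (i < n)%nat -> Q i z.
Proof.
  induction n as [|n IH]; intros H.
  - exists (fun _ => True). split; [apply open_full | split; auto]. intros; lia.
  - destruct IH as (V & HV & Vx & HVQ). { intros i Hi; apply H; lia. }
    destruct (H n) as (W & HW & Wx & HWQ). { lia. }
    exists (fun z => V z /\ W z). split; [now apply open_inter | split; [tauto|]].
    intros z [Vz Wz] i Hi.
    destruct (PeanoNat.Nat.eq_dec i n) as [->|Hn]; auto. apply HVQ; auto; lia.
Qed.

Lemma subset_closure {T : Type} (TT : topology T) (A : T -> Prop) x : A x -> closure TT A x.
Proof. intros Hx C _ HC. auto. Qed.

Lemma closure_closed_eq {T : Type} (TT : topology T) (A : T -> Prop) x :
  closed TT A -> closure TT A x -> A x.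
Proof. intros HA Hx. apply Hx; auto. Qed.

Lemma closure_meets {T : Type} (TT : topology T) (A V : T -> Prop) x :
  closure TT A x -> is_open TT V -> V x -> exists z, V z /\ A z.
Proof.
  intros Hx HV Vx. apply NNPP; intros Hn.
  apply (Hx (fun z => ~ V z)); auto.
  - apply open_ext with V; auto. intro z; split; [tauto | apply NNPP].
  - intros y Ay Vy. apply Hn; eauto.
Qed.

Lemma not_closure_nbhd {T : Type} (TT : topology T) (A : T -> Prop) x :
  ~ closure TT A x -> exists V, is_open TT V /\ V x /\ forall z, V z -> ~ closure TT A z.
Proof.
  intros Hx. apply NNPP; intros Hn. apply Hx. intros C HC HA.
  apply NNPP; intros Cx. apply Hn. exists (fun z => ~ C z).
  split; [exact HC | split; [exact Cx |]]. intros z Cz Hz. apply Cz, Hz; auto.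
Qed.

(** * Maps out of the real line *)

(** Paths are handled as functions on the whole line, so that reparametrizing and gluing need no
    proofs of membership in the unit interval; [clampI] converts from [I] later. *)
Definition cont {T : Type} (TT : topology T) (f : R -> T) : Prop :=
  forall V, is_open TT V -> forall t, V (f t) ->
  exists e, 0 < e /\ forall s, Rabs (s - t) < e -> V (f s).

Definition cont2 {T : Type} (TT : topology T) (H : R -> R -> T) : Prop :=
  forall V, is_open TT V -> forall s t, V (H s t) ->
  exists e, 0 < e /\
    forall s' t', Rabs (s' - s) < e -> Rabs (t' - t) < e -> V (H s' t').

(** Every reparametrization below is affine or built from minima, maxima and absolute values, so a
    Lipschitz bound follows from linear arithmetic after case distinctions. *)
Definition lipschitz (L : R) (phi : R -> R) : Prop :=
  forall s t, Rabs (phi s - phi t) <= L * Rabs (s - t).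

Lemma cont_const {T : Type} (TT : topology T) (c : T) : cont TT (fun _ => c).
Proof. intros V HV t Ht. exists 1. split; [lra | auto]. Qed.

Lemma cont_map {S T : Type} (TS : topology S) (TT : topology T) (q : S -> T) f :
  continuous TS TT q -> cont TS f -> cont TT (fun t => q (f t)).
Proof. intros Hq Hf V HV t Ht. apply (Hf (fun x => V (q x))); auto. Qed.

Lemma cont2_map {S T : Type} (TS : topology S) (TT : topology T) (q : S -> T) H :
  continuous TS TT q -> cont2 TS H -> cont2 TT (fun s t => q (H s t)).
Proof. intros Hq Hf V HV s t Ht. apply (Hf (fun x => V (q x))); auto. Qed.

Lemma scale_lt (L e x : R) : 0 < L -> x < e / L -> L * x < e.
Proof.
  intros HL Hx. apply Rmult_lt_compat_l with (r := L) in Hx; auto.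
  replace (L * (e / L)) with e in Hx by (field; lra). exact Hx.
Qed.

Lemma cont_lip {T : Type} (TT : topology T) f phi L :
  cont TT f -> 0 < L -> lipschitz L phi -> cont TT (fun t => f (phi t)).
Proof.
  intros Hf HL Hphi V HV t Ht.
  destruct (Hf V HV _ Ht) as (e & He & H).
  exists (e / L). split. { now apply Rdiv_lt_0_compat. }
  intros s Hs. apply H.
  eapply Rle_lt_trans; [apply Hphi | now apply scale_lt].
Qed.

Lemma cont2_lip {T : Type} (TT : topology T) H phi psi L :
  cont2 TT H -> 0 < L -> lipschitz L phi -> lipschitz L psi ->
  cont2 TT (fun s t => H (phi s) (psi t)).
Proof.
  intros HH HL Hphi Hpsi V HV s t Ht.
  destruct (HH V HV _ _ Ht) as (e & He & HV').
  exists (e / L). split. { now apply Rdiv_lt_0_compat. }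
  intros s' t' Hs Ht'. apply HV'.
  - eapply Rle_lt_trans; [apply Hphi | now apply scale_lt].
  - eapply Rle_lt_trans; [apply Hpsi | now apply scale_lt].
Qed.

Lemma cont_lip2 {T : Type} (TT : topology T) f (theta : R -> R -> R) L :
  cont TT f -> 0 < L ->
  (forall s t s' t', Rabs (theta s t - theta s' t') <= L * (Rabs (s - s') + Rabs (t - t'))) ->
  cont2 TT (fun s t => f (theta s t)).
Proof.
  intros Hf HL Hth V HV s t Ht.
  destruct (Hf V HV _ Ht) as (e & He & H).
  exists (e / L / 2). split. { pose proof (Rdiv_lt_0_compat _ _ He HL); lra. }
  intros s' t' Hs Ht'. apply H.
  eapply Rle_lt_trans; [apply Hth | apply scale_lt; auto; lra].
Qed.

Lemma cont2_swap {T : Type} (TT : topology T) H :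
  cont2 TT H -> cont2 TT (fun s t => H t s).
Proof.
  intros HH V HV s t Ht. destruct (HH V HV _ _ Ht) as (e & He & HV').
  exists e; split; auto.
Qed.

Lemma cont2_fst {T : Type} (TT : topology T) f : cont TT f -> cont2 TT (fun s _ => f s).
Proof.
  intros Hf V HV s t Ht. destruct (Hf V HV s Ht) as (e & He & H).
  exists e; split; auto.
Qed.

Definition glue {T : Type} (c : R) (f g : R -> T) (s : R) : T :=
  if Rle_dec s c then f s else g s.

Lemma glue_l {T : Type} c (f g : R -> T) s : s <= c -> glue c f g s = f s.
Proof. unfold glue; destruct (Rle_dec s c); tauto. Qed.

Lemma glue_r {T : Type} c (f g : R -> T) s : f c = g c -> c <= s -> glue c f g s = g s.
Proof.
  unfold glue; intros E Hs; destruct (Rle_dec s c); auto.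
  now replace s with c by lra.
Qed.

Lemma cont2_glue {T : Type} (TT : topology T) c (H K : R -> R -> T) :
  cont2 TT H -> cont2 TT K -> (forall t, H c t = K c t) ->
  cont2 TT (fun s t => glue c (fun s => H s t) (fun s => K s t) s).
Proof.
  intros HH HK E V HV s t Ht.
  destruct (Rtotal_order s c) as [Hs|[->|Hs]].
  - rewrite glue_l in Ht by lra. destruct (HH V HV _ _ Ht) as (e & He & HV').
    exists (Rmin e (c - s)). split. { apply Rmin_pos; lra. }
    intros s' t' Hs' Ht'. rewrite glue_l by case_minmax. apply HV'; case_minmax.
  - rewrite glue_l in Ht by lra. destruct (HH V HV _ _ Ht) as (e & He & HV').
    rewrite E in Ht. destruct (HK V HV _ _ Ht) as (e' & He' & HV'').
    exists (Rmin e e'). split. { apply Rmin_pos; lra. }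
    intros s' t' Hs' Ht'. unfold glue; destruct (Rle_dec s' c).
    + apply HV'; eapply Rlt_le_trans; eauto; apply Rmin_l.
    + apply HV''; eapply Rlt_le_trans; eauto; apply Rmin_r.
  - rewrite glue_r in Ht by (auto; lra). destruct (HK V HV _ _ Ht) as (e & He & HV').
    exists (Rmin e (s - c)). split. { apply Rmin_pos; lra. }
    intros s' t' Hs' Ht'. rewrite glue_r by (auto; case_minmax). apply HV'; case_minmax.
Qed.

Lemma cont_glue {T : Type} (TT : topology T) c (f g : R -> T) :
  cont TT f -> cont TT g -> f c = g c -> cont TT (glue c f g).
Proof.
  intros Hf Hg E V HV t Ht.
  destruct (cont2_glue TT c _ _ (cont2_fst TT f Hf) (cont2_fst TT g Hg) (fun _ => E)
              V HV t 0 Ht) as (e & He & H).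
  exists e; split; auto. intros s Hs. apply (H s 0); auto.
  rewrite Rminus_diag, Rabs_R0; lra.
Qed.

(** * Homotopies relative to the endpoints of an interval *)

(** Fixing the ends for every real [t], and not only between 0 and 1, lets homotopies over adjacent
    intervals be glued as maps of the whole plane. Outside [[u, v]] the values of [g] and [k] do not
    count. *)
Definition ph {T : Type} (TT : topology T) (u v : R) (g k : R -> T) : Prop :=
  exists H, cont2 TT H /\
    (forall s, u <= s <= v -> H s 0 = g s /\ H s 1 = k s) /\
    forall t, H u t = g u /\ H v t = g v.

Lemma ph_ends {T : Type} (TT : topology T) u v g k :
  u <= v -> ph TT u v g k -> g u = k u /\ g v = k v.
Proof.
  intros Huv (H & _ & H1 & H2). split.
  - destruct (H1 u) as [_ <-]; [lra|]. symmetry; apply H2.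
  - destruct (H1 v) as [_ <-]; [lra|]. symmetry; apply H2.
Qed.

Lemma ph_of_eq {T : Type} (TT : topology T) u v g k :
  cont TT g -> (forall s, u <= s <= v -> g s = k s) -> ph TT u v g k.
Proof.
  intros Hg E. exists (fun s _ => g s). repeat split; auto. now apply cont2_fst.
Qed.


Lemma ph_sym {T : Type} (TT : topology T) u v g k :
  u <= v -> ph TT u v g k -> ph TT u v k g.
Proof.
  intros Huv Hp. pose proof (ph_ends _ _ _ _ _ Huv Hp) as [Eu Ev].
  destruct Hp as (H & HH & H1 & H2).
  exists (fun s t => H s (1 - t)). split; [|split].
  - apply cont2_lip with (L := 1) (phi := fun s => s) (psi := fun t => 1 - t); auto;
      [lra | intros s t; case_minmax ..].
  - intros s Hs. rewrite Rminus_0_r, Rminus_diag. split; now apply H1.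
  - intros t. rewrite <- Eu, <- Ev. split; apply H2.
Qed.

Lemma ph_trans {T : Type} (TT : topology T) u v g k h :
  u <= v -> ph TT u v g k -> ph TT u v k h -> ph TT u v g h.
Proof.
  intros Huv Hp Hq. pose proof (ph_ends _ _ _ _ _ Huv Hp) as [Eu Ev].
  destruct Hp as (H & HH & H1 & H2). destruct Hq as (K & HK & K1 & K2).
  (* [H s 1] and [K s 0] agree with [k s] only for [s] in [[u, v]]; clamping [s] makes the two
     halves match at [t = 1 / 2] for every real [s], as gluing demands. *)
  set (c := fun s => Rmax u (Rmin v s)).
  assert (Hc : forall s, u <= c s <= v) by (intro s; unfold c; case_minmax).
  assert (Hc' : forall s, u <= s <= v -> c s = s) by (intros s Hs; unfold c; case_minmax).
  assert (Lc : lipschitz 2 c) by (intros s t; unfold c; case_minmax).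
  exists (fun s t => glue (1 / 2) (fun t => H (c s) (2 * t)) (fun t => K (c s) (2 * t - 1)) t).
  split; [|split].
  - apply cont2_swap with (H := fun t s =>
      glue (1 / 2) (fun t => H (c s) (2 * t)) (fun t => K (c s) (2 * t - 1)) t).
    apply cont2_glue with (H := fun t s => H (c s) (2 * t))
                          (K := fun t s => K (c s) (2 * t - 1)).
    + apply cont2_swap with (H := fun s t => H (c s) (2 * t)).
      apply cont2_lip with (L := 2) (psi := fun t => 2 * t); auto; [lra |].
      intros s t; case_minmax.
    + apply cont2_swap with (H := fun s t => K (c s) (2 * t - 1)).
      apply cont2_lip with (L := 2) (psi := fun t => 2 * t - 1); auto; [lra |].
      intros s t; case_minmax.
    + intros s. replace (2 * (1 / 2)) with 1 by field. rewrite Rminus_diag.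
      rewrite (proj2 (H1 _ (Hc s))), (proj1 (K1 _ (Hc s))). reflexivity.
  - intros s Hs. unfold glue. rewrite (Hc' s Hs).
    destruct (Rle_dec 0 (1 / 2)); [|lra]. destruct (Rle_dec 1 (1 / 2)); [lra|].
    replace (2 * 0) with 0 by ring. replace (2 * 1 - 1) with 1 by ring.
    split; [now apply H1 | now apply K1].
  - intros t. unfold glue. rewrite !Hc' by lra.
    destruct (Rle_dec t (1 / 2)); split; try apply H2;
      [rewrite Eu | rewrite Ev]; apply K2.
Qed.

Lemma ph_glue {T : Type} (TT : topology T) u v w g k g' k' :
  u <= v <= w -> ph TT u v g k -> ph TT v w g' k' -> g v = g' v ->
  ph TT u w (glue v g g') (glue v k k').
Proof.
  intros [Huv Hvw] Hp Hq E.
  pose proof (ph_ends _ _ _ _ _ Huv Hp) as [Eu Ev].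
  pose proof (ph_ends _ _ _ _ _ Hvw Hq) as [Ev' Ew].
  destruct Hp as (H & HH & H1 & H2). destruct Hq as (K & HK & K1 & K2).
  assert (EHK : forall t, H v t = K v t)
    by (intros t; rewrite (proj2 (H2 t)), (proj1 (K2 t)); auto).
  exists (fun s t => glue v (fun s => H s t) (fun s => K s t) s). split; [|split].
  - now apply cont2_glue.
  - intros s Hs. unfold glue. destruct (Rle_dec s v); [apply H1 | apply K1]; lra.
  - intros t. rewrite !(glue_l v _ _ u) by auto.
    rewrite !(glue_r v _ _ w) by auto. split; [apply H2 | apply K2].
Qed.

Lemma ph_lip {T : Type} (TT : topology T) u v u' v' g k phi L :
  u <= v -> ph TT u v g k -> 0 < L -> lipschitz L phi ->
  (forall s, u' <= s <= v' -> u <= phi s <= v) ->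
  (phi u' = u /\ phi v' = v \/ phi u' = v /\ phi v' = u) ->
  ph TT u' v' (fun s => g (phi s)) (fun s => k (phi s)).
Proof.
  intros Huv (H & HH & H1 & H2) HL Hphi Hin Hends.
  exists (fun s t => H (phi s) t). split; [|split].
  - apply cont2_lip with (L := L + 1) (psi := fun t => t); auto; [lra | |].
    + intros s t. eapply Rle_trans; [apply Hphi|].
      pose proof (Rabs_pos (s - t)); lra.
    + intros s t. pose proof (Rmult_le_pos _ _ (Rlt_le _ _ HL) (Rabs_pos (s - t))); lra.
  - intros s Hs. apply H1; auto.
  - intros t. destruct Hends as [[-> ->]|[-> ->]]; split; apply H2.
Qed.

Lemma ph_map {S T : Type} (TS : topology S) (TT : topology T) (q : S -> T) u v g k :
  continuous TS TT q -> ph TS u v g k -> ph TT u v (fun s => q (g s)) (fun s => q (k s)).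
Proof.
  intros Hq (H & HH & H1 & H2). exists (fun s t => q (H s t)). split; [|split].
  - now apply (cont2_map TS).
  - intros s Hs. destruct (H1 s Hs) as [-> ->]; auto.
  - intros t. destruct (H2 t) as [-> ->]; auto.
Qed.

(* When [g] takes values in every neighbourhood of [k], one may jump from [g] to [k]
   at the last moment. *)
Lemma ph_specialize {T : Type} (TT : topology T) u v g k :
  cont TT g -> cont TT k -> g u = k u -> g v = k v ->
  (forall s V, is_open TT V -> V (k s) -> V (g s)) -> ph TT u v g k.
Proof.
  intros Hg Hk Eu Ev Hs.
  exists (fun s t => if Rlt_dec t 1 then g s else k s). split; [|split].
  - intros V HV s t Ht. destruct (Rlt_dec t 1) as [Hlt|Hge].
    + destruct (Hg V HV s Ht) as (e & He & H).
      exists (Rmin e (1 - t)). split. { apply Rmin_pos; lra. }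
      intros s' t' Hs' Ht'. destruct (Rlt_dec t' 1); [apply H|]; case_minmax.
    + destruct (Hk V HV s Ht) as (e & He & H).
      destruct (Hg V HV s (Hs s V HV Ht)) as (e' & He' & H').
      exists (Rmin e e'). split. { apply Rmin_pos; lra. }
      intros s' t' Hs' _. destruct (Rlt_dec t' 1).
      * apply H'. eapply Rlt_le_trans; eauto; apply Rmin_r.
      * apply H. eapply Rlt_le_trans; eauto; apply Rmin_l.
  - intros s Hs'. destruct (Rlt_dec 0 1), (Rlt_dec 1 1); try lra; auto.
  - intros t. destruct (Rlt_dec t 1); auto.
Qed.

(** The parameter rises from [phi s] at unit speed and stops at [psi s]; the bound
    [psi s <= phi s + 1] ensures arrival at time 1. Unlike the convex combination of [phi] and
    [psi], which contains a product of [t] with a function of [s], this deformation is globally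
    Lipschitz. *)
Lemma ph_reparam {T : Type} (TT : topology T) f phi psi L :
  cont TT f -> 1 <= L -> lipschitz L phi -> lipschitz L psi ->
  (forall s, 0 <= s <= 1 -> phi s <= psi s <= phi s + 1) ->
  phi 0 = psi 0 -> phi 1 = psi 1 ->
  ph TT 0 1 (fun s => f (phi s)) (fun s => f (psi s)).
Proof.
  intros Hf HL Lphi Lpsi Hle E0 E1.
  (* [Rmax 0 t] keeps the ends fixed for negative [t] as well. *)
  exists (fun s t => f (Rmin (psi s) (phi s + Rmax 0 t))). split; [|split].
  - apply cont_lip2 with (L := L); auto; [lra|]. intros s t s' t'.
    specialize (Lphi s s'). specialize (Lpsi s s').
    assert (Rabs (t - t') <= L * Rabs (t - t'))
      by (pose proof (Rabs_pos (t - t')); nra).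
    assert (0 <= L * Rabs (s - s')) by (pose proof (Rabs_pos (s - s')); nra).
    rewrite Rmult_plus_distr_l.
    set (a := L * Rabs (s - s')) in *. set (b := L * Rabs (t - t')) in *.
    clearbody a b. case_minmax.
  - intros s Hs. specialize (Hle s Hs). split; f_equal; case_minmax.
  - intros t. split; f_equal; case_minmax.
Qed.

(** * Quotients and approximate lifting of paths *)

Definition is_equiv {X : Type} (Rel : X -> X -> Prop) : Prop :=
  (forall x, Rel x x) /\ (forall x y, Rel x y -> Rel y x) /\
  (forall x y z, Rel x y -> Rel y z -> Rel x z).

Lemma qmap_eq_iff {X : Type} (Rel : X -> X -> Prop) x y :
  is_equiv Rel -> (qmap Rel x = qmap Rel y <-> Rel x y).
Proof.
  intros (Hr & Hs & Ht). split.
  - intros E. apply (f_equal (@proj1_sig _ _)) in E. simpl in E.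
    rewrite E. apply Hr.
  - intros Hxy. unfold qmap. apply eq_sig_hprop; [intros; apply proof_irrelevance|].
    simpl. apply functional_extensionality; intro z.
    apply propositional_extensionality; split; intros Hz.
    + apply Ht with x; auto.
    + apply Ht with y; auto.
Qed.

Lemma quot_surj {X : Type} (Rel : X -> X -> Prop) (y : quot Rel) : exists x, qmap Rel x = y.
Proof. destruct y as [S [x E]]. exists x. subst S. reflexivity. Qed.

Lemma qmap_continuous {X : Type} (TX : topology X) (Rel : X -> X -> Prop) :
  continuous TX (quotient_topology TX Rel) (qmap Rel).
Proof. intros V HV. exact HV. Qed.

Lemma saturated_image_open {X : Type} (TX : topology X) (Rel : X -> X -> Prop) (N : X -> Prop) :
  is_equiv Rel -> is_open TX N -> (forall x y, Rel x y -> N x -> N y) ->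
  exists V, is_open (quotient_topology TX Rel) V /\ forall x, V (qmap Rel x) <-> N x.
Proof.
  intros HR HN Hsat. exists (fun y => exists x, qmap Rel x = y /\ N x).
  assert (E : forall x, (exists x0, qmap Rel x0 = qmap Rel x /\ N x0) <-> N x).
  { intros x. split; [|eauto]. intros (x0 & E & Nx0). apply Hsat with x0; auto.
    now apply qmap_eq_iff. }
  split; auto.
  apply open_ext with N; auto. intros x; symmetry; apply E.
Qed.

(* A path [g] of the quotient, subject to [M], which is homotopic to the image of a path
   of [X] from [x] to [x']. *)
Definition route {X : Type} (TX : topology X) (Rel : X -> X -> Prop)
    (M : R -> quot Rel -> Prop) (u v : R) (x x' : X) : Prop :=
  exists (g : R -> quot Rel) (F : R -> X),
    cont (quotient_topology TX Rel) g /\ cont TX F /\ F u = x /\ F v = x' /\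
    (forall r, u <= r <= v -> M r (g r)) /\
    ph (quotient_topology TX Rel) u v g (fun s => qmap Rel (F s)).

Lemma route_glue {X : Type} (TX : topology X) (Rel : X -> X -> Prop) M u v w x y z :
  u <= v <= w -> route TX Rel M u v x y -> route TX Rel M v w y z ->
  route TX Rel M u w x z.
Proof.
  intros Huvw (g & F & Hg & HF & Fu & Fv & HM & Hp) (g' & F' & Hg' & HF' & Fv' & Fw & HM' & Hp').
  assert (E : g v = g' v).
  { destruct (ph_ends _ _ _ _ _ (proj1 Huvw) Hp) as [_ ->].
    destruct (ph_ends _ _ _ _ _ (proj2 Huvw) Hp') as [-> _]. congruence. }
  assert (EF : F v = F' v) by congruence.
  exists (glue v g g'), (glue v F F'). repeat split.
  - now apply cont_glue.
  - now apply cont_glue.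
  - rewrite glue_l; tauto.
  - rewrite glue_r; tauto.
  - intros r Hr. unfold glue. destruct (Rle_dec r v); [apply HM | apply HM']; lra.
  - replace (fun s => qmap Rel (glue v F F' s))
      with (glue v (fun s => qmap Rel (F s)) (fun s => qmap Rel (F' s))).
    + now apply ph_glue.
    + apply functional_extensionality; intro s. unfold glue. now destruct (Rle_dec s v).
Qed.

Lemma route_lip {X : Type} (TX : topology X) (Rel : X -> X -> Prop) (U : quot Rel -> Prop)
    u v u' v' x x' y y' phi L :
  u <= v -> route TX Rel (fun _ => U) u v x x' -> 0 < L -> lipschitz L phi ->
  (forall s, u' <= s <= v' -> u <= phi s <= v) ->
  (phi u' = u /\ phi v' = v /\ y = x /\ y' = x' \/
   phi u' = v /\ phi v' = u /\ y = x' /\ y' = x) ->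
  route TX Rel (fun _ => U) u' v' y y'.
Proof.
  intros Huv (g & F & Hg & HF & Fu & Fv & HM & Hp) HL Lphi Hin Hends.
  exists (fun s => g (phi s)), (fun s => F (phi s)). repeat split.
  - now apply cont_lip with L.
  - now apply cont_lip with L.
  - destruct Hends as [(-> & _ & -> & _)|(-> & _ & -> & _)]; auto.
  - destruct Hends as [(_ & -> & _ & ->)|(_ & -> & _ & ->)]; auto.
  - intros r Hr. apply HM; auto.
  - apply (ph_lip _ u v u' v' g (fun s => qmap Rel (F s)) phi L); auto.
    destruct Hends; tauto.
Qed.

Lemma lipschitz_affine a b L : Rabs a <= L -> lipschitz L (fun s => a * s + b).
Proof.
  intros Ha s t. replace (a * s + b - (a * t + b)) with (a * (s - t)) by ring.
  rewrite Rabs_mult. apply Rmult_le_compat_r; auto. apply Rabs_pos.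
Qed.

Definition linked {X : Type} (TX : topology X) (Rel : X -> X -> Prop)
    (U : quot Rel -> Prop) : X -> X -> Prop :=
  route TX Rel (fun _ => U) 0 1.

Lemma linked_route {X : Type} (TX : topology X) (Rel : X -> X -> Prop) U u v x x' :
  u < v -> linked TX Rel U x x' -> route TX Rel (fun _ => U) u v x x'.
Proof.
  intros Huv H.
  assert (Hi : 0 < / (v - u)) by (apply Rinv_0_lt_compat; lra).
  apply (route_lip TX Rel U 0 1 u v x x' x x' (fun s => / (v - u) * s + - u * / (v - u))
           (/ (v - u))); auto; [lra | | |].
  - apply lipschitz_affine. rewrite Rabs_pos_eq; lra.
  - intros s Hs. replace (/ (v - u) * s + - u * / (v - u)) with ((s - u) * / (v - u)) by ring.
    split.
    + apply Rmult_le_pos; lra.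
    + apply Rmult_le_reg_r with (v - u); [lra|].
      rewrite Rmult_assoc, Rinv_l by lra. lra.
  - left. repeat split; field; lra.
Qed.

Lemma route_linked {X : Type} (TX : topology X) (Rel : X -> X -> Prop) U u v x x' :
  u < v -> route TX Rel (fun _ => U) u v x x' -> linked TX Rel U x x'.
Proof.
  intros Huv H.
  apply (route_lip TX Rel U u v 0 1 x x' x x' (fun s => (v - u) * s + u) (v - u));
    auto; [lra | lra | | |].
  - apply lipschitz_affine. rewrite Rabs_pos_eq; lra.
  - intros s Hs. nra.
  - left. repeat split; ring.
Qed.

Lemma linked_sym {X : Type} (TX : topology X) (Rel : X -> X -> Prop) U x y :
  linked TX Rel U x y -> linked TX Rel U y x.
Proof.
  intros H. apply (route_lip TX Rel U 0 1 0 1 x y y x (fun s => -1 * s + 1) 1); auto; try lra.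
  - apply lipschitz_affine. case_minmax.
  - intros s Hs; lra.
  - right. repeat split; ring.
Qed.

Lemma linked_trans {X : Type} (TX : topology X) (Rel : X -> X -> Prop) U x y z :
  linked TX Rel U x y -> linked TX Rel U y z -> linked TX Rel U x z.
Proof.
  intros H1 H2. apply route_linked with 0 2; [lra|].
  apply route_glue with 1 y; [lra | exact H1 | apply linked_route; auto; lra].
Qed.

Lemma linked_of_path {X : Type} (TX : topology X) (Rel : X -> X -> Prop)
    (U : quot Rel -> Prop) F :
  cont TX F -> (forall r, 0 <= r <= 1 -> U (qmap Rel (F r))) ->
  linked TX Rel U (F 0) (F 1).
Proof.
  intros HF HU.
  assert (cont (quotient_topology TX Rel) (fun s => qmap Rel (F s)))
    by (apply (cont_map TX); auto; apply qmap_continuous).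
  exists (fun s => qmap Rel (F s)), F. repeat split; auto. now apply ph_of_eq.
Qed.

Lemma linked_refl {X : Type} (TX : topology X) (Rel : X -> X -> Prop) (U : quot Rel -> Prop) x :
  U (qmap Rel x) -> linked TX Rel U x x.
Proof. intros H. apply (linked_of_path TX Rel U (fun _ => x)); auto. apply cont_const. Qed.

(** Let [m] be the supremum of the points where [P] holds. The step from some [s < m] up to [m]
    gives [P m], and the step from [m] to a larger [s] contradicts the choice of [m] unless
    [m = v]. *)
Lemma real_induction (P : R -> Prop) u v :
  u <= v -> P u ->
  (forall t, u <= t <= v -> exists e, 0 < e /\ forall s, u <= s <= v -> Rabs (s - t) < e ->
     (t < s -> P t -> P s) /\ (s < t -> P s -> P t)) ->
  P v.
Proof.
  intros Huv Pu Hstep.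
  destruct (completeness (fun t => u <= t <= v /\ P t)) as [m [Hub Hlub]].
  - exists v. intros t Ht; tauto.
  - exists u. split; [lra | auto].
  - assert (Hm : u <= m <= v).
    { split; [apply Hub; split; [lra | auto] | apply Hlub; intros t Ht; tauto]. }
    destruct (Hstep m Hm) as (e & He & H).
    assert (Pm : P m).
    { destruct (classic (exists s, u <= s <= v /\ P s /\ m - e < s)) as [(s & Hs & Ps & Hse)|Hn].
      - assert (s <= m) by (apply Hub; tauto).
        destruct (Req_dec s m) as [->|Hne]; auto.
        apply (H s); auto; case_minmax.
      - exfalso. assert (m <= m - e); [|lra]. apply Hlub. intros s [Hs Ps].
        apply Rnot_lt_le; intros Hlt. apply Hn; eauto. }
    destruct (Req_dec m v) as [<-|Hne]; auto. exfalso.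
    set (s := Rmin v (m + e / 2)).
    assert (m < s <= v /\ s <= m + e / 2) by (unfold s; case_minmax).
    assert (P s) by (apply (H s); auto; case_minmax).
    assert (s <= m) by (apply Hub; split; [lra | auto]). lra.
Qed.

(** A substitute for local path lifting. The points [x] and [x'] range over entire fibres, so the
    choice of a lift at an intermediate time never obstructs the chaining of links. *)
Definition locally_linked {X : Type} (TX : topology X) (Rel : X -> X -> Prop) : Prop :=
  forall f t U, cont (quotient_topology TX Rel) f ->
    is_open (quotient_topology TX Rel) U -> U (f t) ->
    exists e, 0 < e /\ forall s, Rabs (s - t) < e ->
      forall x x', qmap Rel x = f t -> qmap Rel x' = f s -> linked TX Rel U x x'.

Lemma route_mono {X : Type} (TX : topology X) (Rel : X -> X -> Prop) (M M' : R -> quot Rel -> Prop)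
    u v x x' :
  (forall r y, u <= r <= v -> M r y -> M' r y) ->
  route TX Rel M u v x x' -> route TX Rel M' u v x x'.
Proof.
  intros HM (g & F & H1 & H2 & H3 & H4 & H5 & H6).
  exists g, F. repeat split; auto.
Qed.

(** Near [t] the set [M t] is contained in every [M r], so a link inside [M t] is a route for the
    varying sets over a short interval; real induction chains these routes. *)
Lemma approximate_lift {X : Type} (TX : topology X) (Rel : X -> X -> Prop)
    (f : R -> quot Rel) (M : R -> quot Rel -> Prop) u v a :
  locally_linked TX Rel -> u < v -> cont (quotient_topology TX Rel) f ->
  qmap Rel a = f u -> qmap Rel a = f v ->
  (forall t, is_open (quotient_topology TX Rel) (M t)) ->
  (forall t, u <= t <= v -> M t (f t)) ->
  (forall t, exists e, 0 < e /\ forall s, Rabs (s - t) < e -> forall y, M t y -> M s y) ->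
  route TX Rel M u v a a.
Proof.
  intros HL Huv Hf Eu Ev HMo HMf HMs.
  assert (H : forall x, qmap Rel x = f v -> (v = u -> x = a) -> route TX Rel M u v a x).
  2: { apply H; auto. }
  (* Over the degenerate interval at [u] only [a] itself can be reached from [a]; for [t > u] there
     is room to reach every point of the fibre. *)
  apply (real_induction (fun t => forall x, qmap Rel x = f t -> (t = u -> x = a) ->
                                   route TX Rel M u t a x) u v); [lra | |].
  - intros x _ Ex. rewrite (Ex eq_refl).
    exists (fun _ => qmap Rel a), (fun _ => a). repeat split; try apply cont_const.
    + intros r Hr. rewrite Eu. replace r with u by lra. apply HMf; lra.
    + apply ph_of_eq; auto. apply cont_const.
  - intros t Ht.
    destruct (HL f t (M t) Hf (HMo t) (HMf t Ht)) as (e1 & He1 & H1).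
    destruct (HMs t) as (e2 & He2 & H2).
    exists (Rmin e1 e2). split. { now apply Rmin_pos. }
    intros s Hs Hst.
    assert (Hst1 : Rabs (s - t) < e1) by (eapply Rlt_le_trans; [exact Hst | apply Rmin_l]).
    assert (Hst2 : Rabs (s - t) < e2) by (eapply Rlt_le_trans; [exact Hst | apply Rmin_r]).
    split; intros Hlt HP x' Ex' Hx'.
    + assert (Hx : exists x, qmap Rel x = f t /\ (t = u -> x = a)).
      { destruct (Req_dec t u) as [->|Hne]; [exists a; auto|].
        destruct (quot_surj Rel (f t)) as [x Ex]. exists x; split; auto; lra. }
      destruct Hx as (x & Ex & Hxa).
      apply route_glue with t x; [lra | now apply HP |].
      apply route_mono with (fun _ => M t).
      * intros r y Hr. apply H2. case_minmax.
      * apply linked_route; auto. now apply (H1 s).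
    + assert (Hx : exists x, qmap Rel x = f s /\ (s = u -> x = a)).
      { destruct (Req_dec s u) as [->|Hne]; [exists a; auto|].
        destruct (quot_surj Rel (f s)) as [x Ex]. exists x; split; auto; lra. }
      destruct Hx as (x & Ex & Hxa).
      apply route_glue with s x; [lra | now apply HP |].
      apply route_mono with (fun _ => M t).
      * intros r y Hr. apply H2. case_minmax.
      * apply linked_route; auto. apply linked_sym. now apply (H1 s).
Qed.

(** * Loops parametrized by the unit interval *)

Definition clampI (t : R) : I.
Proof.
  refine (exist _ (Rmax 0 (Rmin 1 t)) _). abstract case_minmax.
Defined.

Lemma I_eq (a b : I) : proj1_sig a = proj1_sig b -> a = b.
Proof. intros E. apply eq_sig_hprop; auto. intros; apply proof_irrelevance. Qed.

Lemma clampI_val t : 0 <= t <= 1 -> proj1_sig (clampI t) = t.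
Proof. intros Ht. simpl. case_minmax. Qed.

Lemma clampI_proj (t : I) : clampI (proj1_sig t) = t.
Proof. apply I_eq, clampI_val, (proj2_sig t). Qed.

Lemma clampI_0 : clampI 0 = I0.
Proof. apply (clampI_proj I0). Qed.

Lemma clampI_1 : clampI 1 = I1.
Proof. apply (clampI_proj I1). Qed.

Lemma clampI_lip s t : Rabs (proj1_sig (clampI s) - proj1_sig (clampI t)) <= Rabs (s - t).
Proof. simpl. case_minmax. Qed.

Lemma R_top_nbhd U t : is_open R_top U -> U t ->
  exists e, 0 < e /\ forall s, Rabs (s - t) < e -> U s.
Proof.
  intros HU. revert t. induction HU as [U (x & e & He & H)| |U V _ IHU _ IHV|J F _ IH]; intros t Ut.
  - exists (e - Rabs (t - x)). apply H in Ut. split; [lra|].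
    intros s Hs. apply H. case_minmax.
  - exists 1. split; [lra | auto].
  - destruct Ut as [Ut Vt].
    destruct (IHU t Ut) as (e & He & H), (IHV t Vt) as (e' & He' & H').
    exists (Rmin e e'). split. { now apply Rmin_pos. }
    intros s Hs. split; [apply H | apply H']; eapply Rlt_le_trans;
      [exact Hs | apply Rmin_l | exact Hs | apply Rmin_r].
  - destruct Ut as [j Ut]. destruct (IH j t Ut) as (e & He & H). exists e; eauto.
Qed.

Lemma I_top_nbhd V (t : I) : is_open I_top V -> V t ->
  exists e, 0 < e /\ forall s : I, Rabs (proj1_sig s - proj1_sig t) < e -> V s.
Proof.
  intros HV. revert t. induction HV as [V (U & HU & H)| |U V _ IHU _ IHV|J F _ IH]; intros t Vt.
  - apply H in Vt. destruct (R_top_nbhd U _ HU Vt) as (e & He & HU').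
    exists e. split; auto. intros s Hs. apply H; auto.
  - exists 1. split; [lra | auto].
  - destruct Vt as [Ut Vt].
    destruct (IHU t Ut) as (e & He & H), (IHV t Vt) as (e' & He' & H').
    exists (Rmin e e'). split. { now apply Rmin_pos. }
    intros s Hs. split; [apply H | apply H']; eapply Rlt_le_trans;
      [exact Hs | apply Rmin_l | exact Hs | apply Rmin_r].
  - destruct Vt as [j Vt]. destruct (IH j t Vt) as (e & He & H). exists e; eauto.
Qed.

Lemma I_top_ball (t : I) e : 0 < e ->
  is_open I_top (fun s => Rabs (proj1_sig s - proj1_sig t) < e).
Proof.
  intros He. apply go_sub. exists (fun y => Rabs (y - proj1_sig t) < e).
  split; [|tauto]. apply go_sub. exists (proj1_sig t), e. tauto.
Qed.

Lemma I_top_open V :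
  (forall t : I, V t -> exists e, 0 < e /\
     forall s : I, Rabs (proj1_sig s - proj1_sig t) < e -> V s) -> is_open I_top V.
Proof.
  intros H. apply open_of_nbhd. intros t Vt. destruct (H t Vt) as (e & He & HV).
  exists (fun s => Rabs (proj1_sig s - proj1_sig t) < e).
  split; [now apply I_top_ball | split; auto].
  rewrite Rminus_diag, Rabs_R0; auto.
Qed.

Lemma II_top_nbhd V (s t : I) : is_open (product_topology I_top I_top) V -> V (s, t) ->
  exists e, 0 < e /\ forall s' t' : I, Rabs (proj1_sig s' - proj1_sig s) < e ->
    Rabs (proj1_sig t' - proj1_sig t) < e -> V (s', t').
Proof.
  intros HV. revert s t.
  induction HV as [V (U & W & HU & HW & H)| |U V _ IHU _ IHV|J F _ IH]; intros s t Vt.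
  - apply H in Vt. simpl in Vt. destruct Vt as [Us Wt].
    destruct (I_top_nbhd U s HU Us) as (e & He & HU').
    destruct (I_top_nbhd W t HW Wt) as (e' & He' & HW').
    exists (Rmin e e'). split. { now apply Rmin_pos. }
    intros s' t' Hs Ht. apply H. simpl.
    split; [apply HU' | apply HW']; eapply Rlt_le_trans;
      [exact Hs | apply Rmin_l | exact Ht | apply Rmin_r].
  - exists 1. split; [lra | auto].
  - destruct Vt as [Ut Vt].
    destruct (IHU s t Ut) as (e & He & H), (IHV s t Vt) as (e' & He' & H').
    exists (Rmin e e'). split. { now apply Rmin_pos. }
    intros s' t' Hs Ht. split; [apply H | apply H']; eapply Rlt_le_trans;
      [exact Hs | apply Rmin_l | exact Ht | apply Rmin_l
      |exact Hs | apply Rmin_r | exact Ht | apply Rmin_r].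
  - destruct Vt as [j Vt]. destruct (IH j s t Vt) as (e & He & H). exists e; eauto.
Qed.

Lemma cont_clampI {T : Type} (TT : topology T) (g : I -> T) :
  continuous I_top TT g -> cont TT (fun t => g (clampI t)).
Proof.
  intros Hg V HV t Ht.
  destruct (I_top_nbhd _ _ (Hg V HV) Ht) as (e & He & H).
  exists e; split; auto. intros s Hs. apply H.
  eapply Rle_lt_trans; [apply clampI_lip | auto].
Qed.

Lemma continuous_proj {T : Type} (TT : topology T) (f : R -> T) :
  cont TT f -> continuous I_top TT (fun t => f (proj1_sig t)).
Proof.
  intros Hf V HV. apply I_top_open. intros t Ht.
  destruct (Hf V HV _ Ht) as (e & He & H). exists e; auto.
Qed.

Lemma cont2_clampI {T : Type} (TT : topology T) (H : I * I -> T) :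
  continuous (product_topology I_top I_top) TT H ->
  cont2 TT (fun s t => H (clampI s, clampI t)).
Proof.
  intros HH V HV s t Ht.
  destruct (II_top_nbhd _ _ _ (HH V HV) Ht) as (e & He & HV').
  exists e; split; auto. intros s' t' Hs Ht'. apply HV'.
  - eapply Rle_lt_trans; [apply clampI_lip | auto].
  - eapply Rle_lt_trans; [apply clampI_lip | auto].
Qed.

Lemma continuous_proj2 {T : Type} (TT : topology T) (H : R -> R -> T) :
  cont2 TT H ->
  continuous (product_topology I_top I_top) TT
    (fun z => H (proj1_sig (fst z)) (proj1_sig (snd z))).
Proof.
  intros HH V HV. apply open_of_nbhd. intros [s t] Ht. simpl in Ht.
  destruct (HH V HV _ _ Ht) as (e & He & HV').
  exists (fun z : I * I => Rabs (proj1_sig (fst z) - proj1_sig s) < e /\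
                           Rabs (proj1_sig (snd z) - proj1_sig t) < e).
  split; [|split].
  - apply go_sub. do 2 eexists.
    split; [apply (I_top_ball s e He) | split; [apply (I_top_ball t e He) | tauto]].
  - simpl. rewrite !Rminus_diag, Rabs_R0; auto.
  - intros [s' t'] [Hs Ht']; simpl in *; auto.
Qed.

Lemma loop_homotopic_iff_ph {T : Type} (TT : topology T) y (f g : I -> T) :
  f I0 = y -> f I1 = y ->
  (loop_homotopic TT y f g <-> ph TT 0 1 (fun t => f (clampI t)) (fun t => g (clampI t))).
Proof.
  intros E0 E1. split.
  - intros (H & HH & H1). exists (fun s t => H (clampI s, clampI t)). split; [|split].
    + now apply cont2_clampI.
    + intros s _. rewrite clampI_0, clampI_1.
      destruct (H1 (clampI s) I0) as (-> & -> & _); auto.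
    + intros t. rewrite clampI_0, clampI_1.
      destruct (H1 I0 (clampI t)) as (_ & _ & -> & ->); auto.
  - intros (H & HH & H1 & H2).
    exists (fun z => H (proj1_sig (fst z)) (proj1_sig (snd z))). split.
    + now apply continuous_proj2.
    + intros s t. simpl. destruct (H1 (proj1_sig s) (proj2_sig s)) as [-> ->].
      destruct (H2 (proj1_sig t)) as [-> ->].
      now rewrite clampI_proj, clampI_0, clampI_1, E0, E1.
Qed.

Lemma pi1_rel_equiv {T : Type} (TT : topology T) y : is_equiv (pi1_rel TT y).
Proof.
  assert (E : forall f g : loops TT y, pi1_rel TT y f g <->
    ph TT 0 1 (fun t => proj1_sig f (clampI t)) (fun t => proj1_sig g (clampI t))).
  { intros [f (Hf & E0 & E1)] g. unfold pi1_rel; simpl. now apply loop_homotopic_iff_ph. }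
  split; [|split].
  - intros f. apply E, ph_of_eq; auto. apply cont_clampI, (proj2_sig f).
  - intros f g H. apply E, ph_sym, E; auto; lra.
  - intros f g h H1 H2. apply E. apply ph_trans with (fun t => proj1_sig g (clampI t)).
    + lra.
    + now apply E.
    + now apply E.
Qed.

(** The complements of shrinking closed balls about [t] cover [K]; a finite subcover leaves a ball
    about [t] free of [K]. *)
Lemma compact_I_closed (K : I -> Prop) (t : I) : Defs.compact I_top K -> ~ K t ->
  exists e, 0 < e /\ forall s : I, Rabs (proj1_sig s - proj1_sig t) < e -> ~ K s.
Proof.
  intros HK Kt.
  destruct (HK nat (fun j s => / INR (S j) < Rabs (proj1_sig s - proj1_sig t))) as [l Hl].
  - intros j. apply I_top_open. intros s Hs.
    exists (Rabs (proj1_sig s - proj1_sig t) - / INR (S j)). split; [lra|].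
    intros s' Hs'. revert Hs Hs'. generalize (/ INR (S j)). intros c Hs Hs'. case_minmax.
  - intros s Ks.
    assert (0 < Rabs (proj1_sig s - proj1_sig t)) as Hpos.
    { apply Rabs_pos_lt. intros E. apply Kt.
      now rewrite <- (I_eq s t) by lra. }
    destruct (archimed_cor1 _ Hpos) as (N & HN & HN0).
    exists (pred N). now replace (S (pred N)) with N by lia.
  - assert (exists e, 0 < e /\ forall j, In j l -> e <= / INR (S j)) as (e & He & H).
    { clear Hl. induction l as [|j l (e & He & IH)].
      - exists 1. split; [lra | intros j []].
      - exists (Rmin e (/ INR (S j))). split.
        + apply Rmin_pos; auto. apply Rinv_0_lt_compat, lt_0_INR; lia.
        + intros j' [<-|Hj]; [apply Rmin_r|].
          eapply Rle_trans; [apply Rmin_l | auto]. }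
    exists e; split; auto. intros s Hs Ks.
    destruct (Hl s Ks) as (j & Hj & Hlt). specialize (H j Hj). lra.
Qed.

(** A subbasic set given by [K] and [U] becomes the family equal to [U] at times in [K] and to the
    whole space elsewhere. Since [K] is closed, such a family can only grow near a given time; this
    property survives finite intersections and is what [approximate_lift] consumes. *)
Lemma loop_space_nbhd {T : Type} (TT : topology T) y (W : loops TT y -> Prop) (l : loops TT y) :
  is_open (loop_space_topology TT y) W -> W l ->
  exists M : I -> T -> Prop,
    (forall t, is_open TT (M t)) /\ (forall t, M t (proj1_sig l t)) /\
    (forall t, exists e, 0 < e /\ forall s : I,
        Rabs (proj1_sig s - proj1_sig t) < e -> forall z, M t z -> M s z) /\
    forall l' : loops TT y, (forall t, M t (proj1_sig l' t)) -> W l'.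
Proof.
  intros HW. revert l.
  induction HW as [W (K & U & HK & HU & H)| |W W' _ IH _ IH'|J F _ IH]; intros l Wl.
  - exists (fun t z => K t -> U z). split; [|split; [|split]].
    + intros t. now apply open_imp.
    + now apply H.
    + intros t. destruct (classic (K t)) as [Kt|Kt].
      * exists 1. split; [lra | auto].
      * destruct (compact_I_closed K t HK Kt) as (e & He & HKe).
        exists e. split; auto. intros s Hs z _ Ks. now apply HKe in Hs.
    + intros l' Hl'. now apply H.
  - exists (fun _ _ => True). split; [|split; [|split]]; auto.
    + intros; apply open_full.
    + intros; exists 1. split; [lra | auto].
  - destruct Wl as [Wl Wl'].
    destruct (IH l Wl) as (M & M1 & M2 & M3 & M4), (IH' l Wl') as (M' & M1' & M2' & M3' & M4').
    exists (fun t z => M t z /\ M' t z). split; [|split; [|split]]; auto.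
    + intros t. now apply open_inter.
    + intros t. destruct (M3 t) as (e & He & HM), (M3' t) as (e' & He' & HM').
      exists (Rmin e e'). split. { now apply Rmin_pos. }
      intros s Hs z [Mz Mz'].
      split; [apply HM | apply HM']; auto; eapply Rlt_le_trans;
        [exact Hs | apply Rmin_l | exact Hs | apply Rmin_r].
    + intros l' Hl'. split; [apply M4 | apply M4']; intros t; apply Hl'.
  - destruct Wl as [j Wl]. destruct (IH j l Wl) as (M & M1 & M2 & M3 & M4).
    exists M. repeat split; auto. intros l' Hl'. exists j; auto.
Qed.

(** * Fundamental groups of quotients of simply connected spaces *)

(** Membership in [W] is thereby tested on functions of a real variable; only their values on the
    unit interval matter. *)
Definition represents {T : Type} {TT : topology T} {y : T} (W : loops TT y -> Prop)
    (f : R -> T) : Prop :=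
  exists l, W l /\ forall t : I, proj1_sig l t = f (proj1_sig t).

Lemma represents_ph {T : Type} (TT : topology T) y (W : loops TT y -> Prop) f g :
  (forall l l', pi1_rel TT y l l' -> W l -> W l') ->
  represents W f -> cont TT g -> ph TT 0 1 f g -> represents W g.
Proof.
  intros Hsat (l & Wl & El) Hg Hp.
  destruct (ph_ends _ _ _ _ _ Rle_0_1 Hp) as [E0 E1].
  pose proof (proj2_sig l) as (Hl & El0 & El1). simpl in Hl, El0, El1.
  assert (Hl' : continuous I_top TT (fun t => g (proj1_sig t)) /\
                g (proj1_sig I0) = y /\ g (proj1_sig I1) = y).
  { split; [now apply continuous_proj|]. simpl. rewrite <- E0, <- E1.
    rewrite El in El0, El1. auto. }
  exists (exist _ (fun t => g (proj1_sig t)) Hl'). split; auto.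
  apply Hsat with l; auto. unfold pi1_rel. simpl.
  apply loop_homotopic_iff_ph; auto.
  destruct Hp as (H & HH & H1 & H2). exists H. split; [|split]; auto.
  - intros s Hs. rewrite El, clampI_val by auto. auto.
  - intros t. rewrite !El, !clampI_val by lra. auto.
Qed.

Lemma simply_connected_ph {X : Type} (TX : topology X) u v F :
  simply_connected TX -> u < v -> cont TX F -> F u = F v ->
  ph TX u v F (fun _ => F u).
Proof.
  intros [_ HS] Huv HF E.
  set (phi := fun s => (v - u) * s + u).
  assert (Lphi : lipschitz (v - u) phi)
    by (apply lipschitz_affine; rewrite Rabs_pos_eq; lra).
  assert (HG : cont TX (fun s => F (phi s))) by (apply cont_lip with (v - u); auto; lra).
  assert (E0 : phi 0 = u) by (unfold phi; ring).
  assert (E1 : phi 1 = v) by (unfold phi; ring).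
  pose proof (HS (F u) _ (continuous_proj TX _ HG)) as Hp. simpl in Hp.
  rewrite E0, E1 in Hp. specialize (Hp eq_refl (eq_sym E)).
  apply loop_homotopic_iff_ph in Hp; [|simpl; congruence ..].
  assert (Hi : 0 < / (v - u)) by (apply Rinv_0_lt_compat; lra).
  set (psi := fun s => / (v - u) * s + - u * / (v - u)).
  assert (Lpsi : lipschitz (/ (v - u)) psi)
    by (apply lipschitz_affine; rewrite Rabs_pos_eq; lra).
  assert (Hpsi : forall s, phi (psi s) = s) by (intros s; unfold phi, psi; field; lra).
  assert (Hin : forall s, u <= s <= v -> 0 <= psi s <= 1).
  { intros s Hs. unfold psi.
    replace (/ (v - u) * s + - u * / (v - u)) with ((s - u) * / (v - u)) by ring. split.
    - apply Rmult_le_pos; lra.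
    - apply Rmult_le_reg_r with (v - u); [lra|].
      rewrite Rmult_assoc, Rinv_l by lra. lra. }
  eapply ph_lip with (u' := u) (v' := v) (phi := psi) in Hp; eauto; [|lra|].
  - apply ph_trans with (2 := ph_of_eq TX u v F
      (fun s => F (phi (proj1_sig (clampI (psi s))))) HF
      (fun s Hs => eq_sym (f_equal F (eq_trans
         (f_equal phi (clampI_val _ (Hin s Hs))) (Hpsi s))))); auto; lra.
  - left. unfold psi. split; field; lra.
Qed.

(** On [[1/2, 1]] an approximate lift replaces [f] by a path [g] that keeps the loop in [W] and is
    homotopic to the image of a closed path of X at [a]. That path contracts in X, hence its image
    contracts in the quotient, and [W] is saturated under homotopy. *)
Lemma represents_truncate {X : Type} (TX : topology X) (Rel : X -> X -> Prop) a
    (W : loops (quotient_topology TX Rel) (qmap Rel a) -> Prop) f :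
  simply_connected TX -> locally_linked TX Rel ->
  is_open (loop_space_topology _ _) W -> (forall l l', pi1_rel _ _ l l' -> W l -> W l') ->
  cont (quotient_topology TX Rel) f -> f (1 / 2) = qmap Rel a ->
  represents W f -> represents W (glue (1 / 2) f (fun _ => qmap Rel a)).
Proof.
  intros HS HL HW Hsat Hf Ef (l & Wl & El).
  pose proof (proj2_sig l) as (_ & El0 & El1). simpl in El0, El1. rewrite El in El0, El1.
  simpl in El0, El1.
  destruct (loop_space_nbhd _ _ W l HW Wl) as (M & M1 & M2 & M3 & M4).
  assert (Mf : forall t, 0 <= t <= 1 -> M (clampI t) (f t)).
  { intros t Ht. specialize (M2 (clampI t)). rewrite El, clampI_val in M2; auto. }
  destruct (approximate_lift TX Rel f (fun t => M (clampI t)) (1 / 2) 1 a)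
    as (g & F & Hg & HF & F0 & F1 & HMg & Hp); auto; try lra.
  - intros t Ht. apply Mf; lra.
  - intros t. destruct (M3 (clampI t)) as (e & He & H). exists e; split; auto.
    intros s Hs. apply H. eapply Rle_lt_trans; [apply clampI_lip | auto].
  - assert (Hhalf : 1 / 2 <= 1) by lra.
    destruct (ph_ends _ _ _ _ _ Hhalf Hp) as [Eg0 Eg1]. rewrite F0 in Eg0. rewrite F1 in Eg1.
    assert (Hgl : cont (quotient_topology TX Rel) (glue (1 / 2) f g))
      by (apply cont_glue; auto; congruence).
    assert (Hl' : continuous I_top (quotient_topology TX Rel)
                    (fun t => glue (1 / 2) f g (proj1_sig t)) /\
                  glue (1 / 2) f g (proj1_sig I0) = qmap Rel a /\
                  glue (1 / 2) f g (proj1_sig I1) = qmap Rel a).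
    { split; [now apply continuous_proj|]. simpl. split.
      - rewrite glue_l; auto; lra.
      - rewrite glue_r; auto; congruence. }
    apply represents_ph with (glue (1 / 2) f g); auto.
    + exists (exist _ (fun t => glue (1 / 2) f g (proj1_sig t)) Hl').
      split; auto. apply M4. intros [t Ht]. simpl.
      rewrite <- (clampI_proj (exist _ t Ht)). simpl. unfold glue.
      destruct (Rle_dec t (1 / 2)); [apply Mf | apply HMg]; lra.
    + apply cont_glue; auto. apply cont_const.
    + apply ph_glue; [lra | now apply ph_of_eq | | congruence].
      eapply ph_trans; [lra | exact Hp |].
      rewrite <- F0. apply (ph_map TX); [apply qmap_continuous|].
      apply simply_connected_ph; auto; [lra | congruence].
Qed.

Lemma indiscrete_of_locally_linked {X : Type} (TX : topology X) (Rel : X -> X -> Prop) a :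
  simply_connected TX -> locally_linked TX Rel ->
  indiscrete (pi1_top (quotient_topology TX Rel) (qmap Rel a)).
Proof.
  intros HS HL U HU.
  destruct (classic (exists x, U x)) as [[x Ux]|Hn]; [right | left; eauto].
  set (W := fun l => U (qmap (pi1_rel (quotient_topology TX Rel) (qmap Rel a)) l)).
  assert (HW : is_open (loop_space_topology (quotient_topology TX Rel) (qmap Rel a)) W)
    by exact HU.
  assert (Hsat : forall l l', pi1_rel _ _ l l' -> W l -> W l').
  { intros l l' Hll'. unfold W.
    rewrite (proj2 (qmap_eq_iff _ l l' (pi1_rel_equiv _ _)) Hll'). auto. }
  assert (Hloop : forall l : loops (quotient_topology TX Rel) (qmap Rel a),
    cont (quotient_topology TX Rel) (fun t => proj1_sig l (clampI t)) /\
    (forall t, t <= 0 -> proj1_sig l (clampI t) = qmap Rel a) /\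
    (forall t, 1 <= t -> proj1_sig l (clampI t) = qmap Rel a)).
  { intros [l (Hl & E0 & E1)]; simpl. split; [now apply cont_clampI|]. split; intros t Ht.
    - rewrite <- E0. f_equal. apply I_eq. simpl. case_minmax.
    - rewrite <- E1. f_equal. apply I_eq. simpl. case_minmax. }
  assert (Hconst : represents W (fun _ => qmap Rel a)).
  { destruct (quot_surj _ x) as [h Eh]. subst x.
    destruct (Hloop h) as (Hh & H0 & H1).
    set (hR := fun t => proj1_sig h (clampI t)) in *.
    (* The loop [hR] is delayed to the second half, the first half being constant; truncation then
       leaves the constant loop. *)
    assert (L1 : lipschitz 2 (fun s => Rmax 0 (2 * s - 1))) by (intros s t; case_minmax).
    assert (L2 : lipschitz 2 (fun s => s)) by (intros s t; case_minmax).
    assert (Hk : cont (quotient_topology TX Rel) (fun s => hR (Rmax 0 (2 * s - 1))))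
      by (apply cont_lip with 2; auto; lra).
    assert (Hr : represents W (fun s => hR (Rmax 0 (2 * s - 1)))).
    { apply represents_ph with hR; auto.
      - exists h. split; auto. intros t. unfold hR. now rewrite clampI_proj.
      - apply ph_sym; [lra|].
        apply (ph_reparam _ hR (fun s => Rmax 0 (2 * s - 1)) (fun s => s) 2); auto; try lra.
        + intros s Hs. case_minmax.
        + case_minmax.
        + case_minmax. }
    apply represents_truncate in Hr; auto.
    - destruct Hr as (l & Wl & El). exists l. split; auto. intros t. rewrite El.
      unfold glue. destruct (Rle_dec (proj1_sig t) (1 / 2)); auto.
      apply H0. case_minmax.
    - apply H0. case_minmax. }
  intros x'. destruct (quot_surj _ x') as [l El]. subst x'.
  destruct (Hloop l) as (Hl & H0 & H1).
  set (f := fun t => proj1_sig l (clampI t)) in *.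
  (* [f (tent s)] runs through [f] and then back, and is homotopic to the constant loop by raising
     the parameter from 0 to [tent s]. Truncation removes the way back and leaves [f] at double
     speed. *)
  set (tent := fun s => 1 - Rabs (1 - 2 * s)).
  assert (Lt : lipschitz 2 tent) by (intros s t; unfold tent; case_minmax).
  assert (L0 : lipschitz 2 (fun _ => 0)) by (intros s t; case_minmax).
  assert (L1 : lipschitz 2 (fun s => Rmin (2 * s) 1)) by (intros s t; case_minmax).
  assert (L2 : lipschitz 2 (fun s => s)) by (intros s t; case_minmax).
  assert (Hr : represents W (fun s => f (tent s))).
  { apply represents_ph with (fun _ => qmap Rel a); auto.
    - apply cont_lip with 2; auto; lra.
    - rewrite <- (H0 0) by lra.
      apply (ph_reparam _ f (fun _ => 0) tent 2); auto; try lra.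
      + intros s Hs. unfold tent; case_minmax.
      + unfold tent; case_minmax.
      + unfold tent; case_minmax. }
  apply represents_truncate in Hr; auto.
  2: { apply cont_lip with 2; auto; lra. }
  2: { apply H1. unfold tent; case_minmax. }
  assert (Hf : represents W f).
  { apply represents_ph with (fun s => f (Rmin (2 * s) 1)); auto.
    - destruct Hr as (l' & Wl & El). exists l'. split; auto. intros t. rewrite El.
      unfold glue. destruct (Rle_dec (proj1_sig t) (1 / 2)).
      + f_equal. unfold tent; case_minmax.
      + symmetry. apply H1. case_minmax.
    - apply ph_sym; [lra|].
      apply (ph_reparam _ f (fun s => s) (fun s => Rmin (2 * s) 1) 2); auto; try lra.
      + intros s Hs. case_minmax.
      + case_minmax.
      + case_minmax. }
  destruct Hf as (l' & Wl & El).
  replace l with l'; auto.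
  apply eq_sig_hprop; [intros; apply proof_irrelevance|].
  apply functional_extensionality; intro t. rewrite El. unfold f. now rewrite clampI_proj.
Qed.

(** * Spaces obtained by collapsing finitely many subsets *)

Lemma ident_rel_equiv {X : Type} n (A : nat -> X -> Prop) : is_equiv (ident_rel n A).
Proof.
  split; [|split].
  - intros x. apply rst_refl.
  - intros x y. apply rst_sym.
  - intros x y z. apply rst_trans.
Qed.

Lemma ident_rel_in {X : Type} n (A : nat -> X -> Prop) i x y :
  (i < n)%nat -> A i x -> A i y -> ident_rel n A x y.
Proof. intros. apply rst_step. eauto. Qed.

(** The conclusion is strengthened to an equivalence so that the symmetry case of the induction goes
    through. *)
Lemma ident_rel_saturated {X : Type} n (A : nat -> X -> Prop) (N : X -> Prop) :
  (forall i x y, (i < n)%nat -> A i x -> A i y -> N x -> N y) ->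
  forall x y, ident_rel n A x y -> N x -> N y.
Proof.
  intros H x y Hxy. enough (N x <-> N y) by tauto.
  induction Hxy as [x y (i & Hi & Ax & Ay)| | |]; try tauto. split; eauto.
Qed.

Lemma ident_rel_outside {X : Type} n (A : nat -> X -> Prop) x y :
  ident_rel n A x y -> (forall i, (i < n)%nat -> ~ A i x) -> x = y.
Proof.
  intros Hxy Hx. symmetry.
  apply (ident_rel_saturated n A (fun z => z = x)) with x; auto.
  intros i z z' Hi Az _ ->. destruct (Hx i Hi Az).
Qed.

Lemma path_connected_real {X : Type} (TX : topology X) (P : X -> Prop) x y :
  path_connected_set TX P -> P x -> P y ->
  exists F, cont TX F /\ (forall t, t <= 0 -> F t = x) /\ (forall t, 1 <= t -> F t = y) /\
            forall t, P (F t).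
Proof.
  intros HP Px Py. destruct (HP x y Px Py) as (g & Hg & E0 & E1 & Pg).
  exists (fun t => g (clampI t)). repeat split; auto.
  - now apply cont_clampI.
  - intros t Ht. rewrite <- E0. f_equal. apply I_eq. simpl. case_minmax.
  - intros t Ht. rewrite <- E1. f_equal. apply I_eq. simpl. case_minmax.
Qed.

Lemma closure_specializes {X : Type} (TX : topology X) n (A : nat -> X -> Prop) i x y
    (V : quot (ident_rel n A) -> Prop) :
  (i < n)%nat -> closure TX (A i) x -> A i y ->
  is_open (quotient_topology TX (ident_rel n A)) V ->
  V (qmap (ident_rel n A) x) -> V (qmap (ident_rel n A) y).
Proof.
  intros Hi Hx Ay HV Vx.
  destruct (closure_meets TX (A i) _ x Hx HV Vx) as (z & Vz & Az).
  rewrite (proj2 (qmap_eq_iff _ y z (ident_rel_equiv n A))); auto.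
  now apply ident_rel_in with i.
Qed.

(* The image of a path of the closure of [A i] is homotopic to the path which jumps
   immediately to the point [p (A i)], because that point is dense in [p (closure (A i))]. *)
Lemma linked_closure {X : Type} (TX : topology X) n (A : nat -> X -> Prop) i x y
    (U : quot (ident_rel n A) -> Prop) :
  (i < n)%nat -> path_connected_set TX (closure TX (A i)) ->
  closure TX (A i) x -> A i y ->
  U (qmap (ident_rel n A) x) -> U (qmap (ident_rel n A) y) ->
  linked TX (ident_rel n A) U x y.
Proof.
  intros Hi HP Hx Ay Ux Uy.
  destruct (path_connected_real TX _ x y HP Hx (subset_closure TX _ y Ay))
    as (F & HF & F0 & F1 & Fcl).
  (* Only the images of [x] and [y] occur as values, so [g] stays in [U] although the image of [F]
     may leave it. Continuity at 0 holds because the image of [y] lies in every neighbourhood of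
     that of [x]. *)
  set (g := fun t => if Rle_dec t 0 then qmap (ident_rel n A) x else qmap (ident_rel n A) y).
  assert (Hspec : forall s V, is_open (quotient_topology TX (ident_rel n A)) V ->
    V (qmap (ident_rel n A) (F s)) -> V (g s)).
  { intros s V HV Vs. unfold g. destruct (Rle_dec s 0); [now rewrite <- (F0 s)|].
    now apply (closure_specializes TX n A i (F s) y V). }
  assert (Hg : cont (quotient_topology TX (ident_rel n A)) g).
  { intros V HV t Vt. unfold g in *. destruct (Rle_dec t 0) as [Ht|Ht].
    - exists 1. split; [lra|]. intros s _. destruct (Rle_dec s 0); auto.
      now apply (closure_specializes TX n A i x y V).
    - exists t. split; [lra|]. intros s Hs. destruct (Rle_dec s 0); auto. case_minmax. }
  exists g, F. split; [auto | split; [auto | split; [|split; [|split]]]].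
  - apply F0; lra.
  - apply F1; lra.
  - intros r _. unfold g. now destruct (Rle_dec r 0).
  - apply ph_specialize; auto.
    + apply (cont_map TX); auto. apply qmap_continuous.
    + unfold g. destruct (Rle_dec 0 0); [now rewrite F0 | lra].
    + unfold g. destruct (Rle_dec 1 0); [lra | rewrite F1; auto; lra].
Qed.

Lemma linked_fiber {X : Type} (TX : topology X) n (A : nat -> X -> Prop)
    (U : quot (ident_rel n A) -> Prop) x y :
  (forall i, (i < n)%nat -> path_connected_set TX (closure TX (A i))) ->
  ident_rel n A x y -> U (qmap (ident_rel n A) x) -> linked TX (ident_rel n A) U x y.
Proof.
  intros HP Hxy.
  assert (HE : forall x y, ident_rel n A x y -> qmap (ident_rel n A) x = qmap (ident_rel n A) y)
    by (intros; apply qmap_eq_iff; auto; apply ident_rel_equiv).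
  induction Hxy as [x y (i & Hi & Ax & Ay)| |x y Hxy IH|x y z Hxy IH1 Hyz IH2]; intros Ux.
  - apply linked_closure with i; auto.
    + now apply subset_closure.
    + rewrite <- (HE x y); auto. now apply ident_rel_in with i.
  - now apply linked_refl.
  - apply linked_sym, IH. now rewrite (HE x y).
  - apply linked_trans with y; auto. apply IH2. now rewrite <- (HE x y).
Qed.

(** A saturated open set [N] around the fibre of [f t] is built from points linked to [x0] inside
    [U]; by continuity [f s] lies in its image for [s] near [t]. *)
Lemma locally_linked_disjoint {X : Type} (TX : topology X) n (A : nat -> X -> Prop) :
  locally_path_connected TX ->
  (forall i, (i < n)%nat -> (is_open TX (A i) \/ closed TX (A i)) /\
                            path_connected_set TX (closure TX (A i))) ->
  (forall i j, (i < n)%nat -> (j < n)%nat -> i <> j ->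
     forall x, ~ (closure TX (A i) x /\ closure TX (A j) x)) ->
  locally_linked TX (ident_rel n A).
Proof.
  intros HX HA HD f t U Hf HU Ut.
  pose proof (ident_rel_equiv n A) as HR.
  assert (HP : forall i, (i < n)%nat -> path_connected_set TX (closure TX (A i)))
    by (intros; now apply HA).
  assert (HD' : forall i j x, (i < n)%nat -> (j < n)%nat ->
            closure TX (A i) x -> closure TX (A j) x -> i = j).
  { intros i j x Hi Hj Hx Hx'. destruct (PeanoNat.Nat.eq_dec i j); auto.
    destruct (HD i j Hi Hj n0 x); auto. }
  destruct (quot_surj _ (f t)) as [x0 E0]. rewrite <- E0 in Ut.
  (* The last clause makes [V] avoid every closure that does not contain [x], so a set [A j] meeting
     [V] has [x] in its closure. *)
  set (good := fun x (V : X -> Prop) => is_open TX V /\ V x /\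
         (forall z, V z -> U (qmap (ident_rel n A) z)) /\ path_connected_set TX V /\
         forall z, V z -> forall j, (j < n)%nat -> closure TX (A j) z -> closure TX (A j) x).
  assert (Hgood : forall x, U (qmap (ident_rel n A) x) -> exists V, good x V).
  { intros x Ux.
    destruct (nbhd_finite_inter TX x
                (fun j z => closure TX (A j) z -> closure TX (A j) x) n) as (V & HV & Vx & HVc).
    { intros j _. destruct (classic (closure TX (A j) x)) as [Hj|Hj].
      - exists (fun _ => True). split; [apply open_full | auto].
      - destruct (not_closure_nbhd TX (A j) x Hj) as (V & HV & Vx & HVj).
        exists V. repeat split; auto. intros z Vz Hz. destruct (HVj z Vz Hz). }
    destruct (HX x (fun z => V z /\ U (qmap (ident_rel n A) z))) as (W & HW & Wx & HWV & HWP).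
    - apply open_inter; auto.
    - auto.
    - exists W. split; [auto | split; [auto | split; [|split; [exact HWP|]]]];
        intros z Wz; destruct (HWV z Wz) as [Vz Uz]; [exact Uz | exact (HVc z Vz)]. }
  (* Every neighbourhood of [x0] meets such an [A i], so saturation forces all of [A i] into [N]. *)
  set (B := fun z => exists i, (i < n)%nat /\ is_open TX (A i) /\ closure TX (A i) x0 /\ A i z).
  set (N := fun z => (exists x V, ident_rel n A x0 x /\ good x V /\ V z) \/ B z).
  destruct (saturated_image_open TX (ident_rel n A) N HR) as (V & HV & HVN).
  - apply open_of_nbhd. intros z [(x & V & Hx & HV & Vz)|(i & Hi & Ho & Hc & Az)].
    + exists V. split; [apply HV | split; auto]. intros w Vw. left; eauto.
    + exists (A i). split; [auto | split; auto]. intros w Aw. right; exists i; auto.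
  - apply ident_rel_saturated.
    intros j z z' Hj Az Az' [(x & V & Hx & HV & Vz)|(i & Hi & Ho & Hc & Az0)].
    + assert (Hjx : closure TX (A j) x).
      { destruct HV as (_ & _ & _ & _ & HV). apply HV with z; auto. now apply subset_closure. }
      (* If [A j] is open, it belongs to [B]: either [x] lies in some [A i], then [i = j] by
         disjointness and [A j] is the fibre of [x0], or the fibre is a single point and [x = x0].
         If [A j] is closed, it contains [x], so [z'] lies in the fibre and has a good neighbourhood
         of its own. *)
      destruct (HA j Hj) as [[Ho|Hcl] _].
      * right. exists j. repeat split; auto.
        destruct (classic (exists i, (i < n)%nat /\ A i x)) as [(i & Hi & Aix)|Hn].
        -- assert (i = j) as -> by (apply HD' with x; auto; now apply subset_closure).
           apply subset_closure.
           apply (ident_rel_saturated n A (A j)) with x; [| now apply rst_sym | auto].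
           intros i w w' Hi' Aw Aw' Ajw.
           assert (i = j) as -> by (apply HD' with w; auto; now apply subset_closure). auto.
        -- rewrite <- (ident_rel_outside n A x x0); auto; [now apply rst_sym | eauto].
      * apply closure_closed_eq in Hjx; auto. left.
        destruct (Hgood z') as (V' & HV').
        { rewrite <- (proj2 (qmap_eq_iff _ x z' HR)).
          - apply HV, HV.
          - now apply ident_rel_in with j. }
        exists z', V'. split; [|split; auto; apply HV'].
        apply rst_trans with x; auto. now apply ident_rel_in with j.
    + assert (i = j) as -> by (apply HD' with z; auto; now apply subset_closure).
      right. exists j; auto.
  (* Inside a good neighbourhood a path of X does it. A point of [B] is reached by going from [x0]
     to some [w] in [A i] within such a neighbourhood and then moving along the fibre of [w]. *)
  - assert (HL : forall z, N z -> linked TX (ident_rel n A) U x0 z).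
    { assert (HV1 : forall x W z, good x W -> W z -> linked TX (ident_rel n A) U x z).
      { intros x W z (HW & Wx & HWU & HWP & _) Wz.
        destruct (path_connected_real TX W x z HWP Wx Wz) as (F & HF & F0 & F1 & HFW).
        rewrite <- (F0 0), <- (F1 1) by lra. apply linked_of_path; auto. }
      intros z [(x & W & Hx & HW & Wz)|(i & Hi & Ho & Hc & Az)].
      - apply linked_trans with x; [now apply linked_fiber | eauto].
      - destruct (Hgood x0 Ut) as (W & HW).
        destruct (closure_meets TX (A i) W x0) as (w & Ww & Aw); auto; try apply HW.
        apply linked_trans with w; [eauto|].
        apply linked_fiber; auto; [now apply ident_rel_in with i | now apply HW]. }
    assert (Vt : V (f t)).
    { rewrite <- E0. apply HVN. left. destruct (Hgood x0 Ut) as (W & HW).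
      exists x0, W. split; [apply rst_refl | split; auto; apply HW]. }
    destruct (Hf V HV t Vt) as (e & He & H). exists e; split; auto.
    intros s Hs x x' Ex Ex'. apply linked_trans with x0.
    + apply linked_fiber; auto.
      * apply (qmap_eq_iff _ x x0 HR). congruence.
      * now rewrite Ex, <- E0.
    + apply HL, HVN. rewrite Ex'. auto.
Qed.

(** If the image of [y] lies in every neighbourhood of the image of [x], then [x] is in the closure
    of some [A j] contained in the class of [y], and [linked_closure] applies. *)
Lemma linked_specialization {X : Type} (TX : topology X) n (A : nat -> X -> Prop)
    (U : quot (ident_rel n A) -> Prop) i x y :
  (forall i, (i < n)%nat -> is_open TX (A i)) ->
  (forall i, (i < n)%nat -> path_connected_set TX (closure TX (A i))) ->
  (i < n)%nat -> A i y ->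
  (forall V, is_open (quotient_topology TX (ident_rel n A)) V ->
     V (qmap (ident_rel n A) x) -> V (qmap (ident_rel n A) y)) ->
  U (qmap (ident_rel n A) x) -> U (qmap (ident_rel n A) y) ->
  linked TX (ident_rel n A) U x y.
Proof.
  intros HO HP Hi Ay Hxy Ux Uy.
  pose proof (ident_rel_equiv n A) as HR.
  destruct (classic (exists j z, (j < n)%nat /\ closure TX (A j) x /\ A j z /\ ident_rel n A z y))
    as [(j & z & Hj & Hx & Az & Hzy)|Hn].
  - pose proof (proj2 (qmap_eq_iff _ z y HR) Hzy) as E.
    apply linked_trans with z.
    + apply linked_closure with j; auto. now rewrite E.
    + apply linked_fiber; auto. now rewrite E.
  - exfalso.
    destruct (nbhd_finite_inter TX x (fun j z => A j z -> ~ ident_rel n A z y) n)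
      as (V & HV & Vx & HVy).
    { intros j Hj. destruct (classic (closure TX (A j) x)) as [Hjx|Hjx].
      - exists (fun _ => True). split; [apply open_full | split; auto].
        intros z _ Az Hzy. apply Hn. exists j, z; auto.
      - destruct (not_closure_nbhd TX (A j) x Hjx) as (V & HV & Vx & HVj).
        exists V. repeat split; auto. intros z Vz Az.
        destruct (HVj z Vz). now apply subset_closure. }
    (* [V] avoids the sets [A j] in the class of [y]; adding all the other [A k] makes it saturated,
       so its image is an open set separating [x] from [y]. *)
    set (N := fun z => V z \/ exists k, (k < n)%nat /\ A k z /\ ~ ident_rel n A z y).
    assert (HA : forall k z z', (k < n)%nat -> A k z -> A k z' -> ~ ident_rel n A z y ->
                   ~ ident_rel n A z' y).
    { intros k z z' Hk Az Az' Hz Hz'. apply Hz. apply rst_trans with z'; auto.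
      now apply ident_rel_in with k. }
    destruct (saturated_image_open TX (ident_rel n A) N HR) as (W & HW & HWN).
    + apply open_of_nbhd. intros z [Vz|(k & Hk & Az & Hz)].
      * exists V. repeat split; auto. intros w Vw; now left.
      * exists (A k). repeat split; auto. intros w Aw. right. exists k. eauto.
    + apply ident_rel_saturated. intros k z z' Hk Az Az' [Vz|(k' & Hk' & Az0 & Hz)].
      * right. exists k. repeat split; auto. apply (HA k z z'); auto. now apply (HVy z Vz k).
      * right. exists k. eauto.
    + specialize (Hxy W HW). rewrite !HWN in Hxy.
      destruct Hxy as [Vy|(k & _ & _ & Hy)].
      * now left.
      * apply (HVy y Vy i Hi Ay). apply rst_refl.
      * apply Hy, rst_refl.
Qed.

(** Away from the [A i] the fibres are single points, so the stretch has only one lift. It is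
    continuous because an open set of X becomes saturated, and stays open, on adding the union of
    the [A i]. *)
Lemma linked_outside {X : Type} (TX : topology X) n (A : nat -> X -> Prop)
    (U : quot (ident_rel n A) -> Prop) f u v x y :
  (forall i, (i < n)%nat -> is_open TX (A i)) ->
  cont (quotient_topology TX (ident_rel n A)) f -> u < v ->
  (forall r, u <= r <= v -> U (f r)) ->
  (forall r z, u <= r <= v -> qmap (ident_rel n A) z = f r ->
     forall i, (i < n)%nat -> ~ A i z) ->
  qmap (ident_rel n A) x = f u -> qmap (ident_rel n A) y = f v ->
  linked TX (ident_rel n A) U x y.
Proof.
  intros HO Hf Huv HU Hout Ex Ey.
  pose proof (ident_rel_equiv n A) as HR.
  set (c := fun s => Rmax u (Rmin v s)).
  assert (Hc : forall s, u <= c s <= v) by (intro s; unfold c; case_minmax).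
  assert (Hc' : forall s, u <= s <= v -> c s = s) by (intros s Hs; unfold c; case_minmax).
  assert (Lc : lipschitz 1 c) by (intros s t; unfold c; case_minmax).
  assert (Hfc : cont (quotient_topology TX (ident_rel n A)) (fun s => f (c s)))
    by (apply cont_lip with 1; auto; lra).
  set (F := fun s => proj1_sig (constructive_indefinite_description _ (quot_surj _ (f (c s))))).
  assert (EF : forall s, qmap (ident_rel n A) (F s) = f (c s))
    by (intros s; unfold F; now destruct constructive_indefinite_description).
  assert (HF : cont TX F).
  { intros N HN t Nt.
    destruct (saturated_image_open TX (ident_rel n A)
                (fun z => N z \/ exists i, (i < n)%nat /\ A i z) HR) as (V & HV & HVN).
    - apply open_of_nbhd. intros z [Nz|(i & Hi & Az)].
      + exists N. auto.
      + exists (A i). repeat split; eauto.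
    - apply ident_rel_saturated. intros; eauto.
    - assert (Vt : V (f (c t))) by (rewrite <- EF; apply HVN; auto).
      destruct (Hfc V HV t Vt) as (e & He & H). exists e; split; auto.
      intros s Hs. specialize (H s Hs). rewrite <- EF in H. apply HVN in H.
      destruct H as [H|(i & Hi & Az)]; auto. destruct (Hout (c s) (F s) (Hc s) (EF s) i Hi Az). }
  assert (HFe : forall s z, u <= s <= v -> qmap (ident_rel n A) z = f s -> F s = z).
  { intros s z Hs Ez. symmetry. apply (ident_rel_outside n A); [|now apply (Hout s)].
    apply (qmap_eq_iff _ z (F s) HR). rewrite EF, Hc'; auto. }
  apply route_linked with u v; auto.
  exists (fun s => qmap (ident_rel n A) (F s)), F.
  assert (HpF : cont (quotient_topology TX (ident_rel n A)) (fun s => qmap (ident_rel n A) (F s)))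
    by (apply (cont_map TX); auto; apply qmap_continuous).
  repeat split; auto.
  - apply HFe; auto; lra.
  - apply HFe; auto; lra.
  - intros r Hr. rewrite EF, Hc'; auto.
  - now apply ph_of_eq.
Qed.

(** The image of each nonempty [A i] is one point, which either lies in every neighbourhood of [y]
    or is excluded by one of them; finitely many exclusions intersect to an open set. *)
Lemma nbhd_specialization {X : Type} (TX : topology X) n (A : nat -> X -> Prop)
    (y : quot (ident_rel n A)) :
  exists V, is_open (quotient_topology TX (ident_rel n A)) V /\ V y /\
    forall i x, (i < n)%nat -> A i x -> V (qmap (ident_rel n A) x) ->
    forall V', is_open (quotient_topology TX (ident_rel n A)) V' -> V' y ->
      V' (qmap (ident_rel n A) x).
Proof.
  set (TY := quotient_topology TX (ident_rel n A)).
  destruct (nbhd_finite_inter TY y (fun i z => forall x, A i x -> z = qmap (ident_rel n A) x ->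
      forall V', is_open TY V' -> V' y -> V' z) n) as (V & HV & Vy & H).
  - intros i Hi.
    destruct (classic (exists x V', A i x /\ is_open TY V' /\ V' y /\
                         ~ V' (qmap (ident_rel n A) x))) as [(x & V' & Ax & HV' & V'y & Hx)|Hn].
    + exists V'. repeat split; auto. intros z V'z x' Ax' ->. exfalso. apply Hx.
      rewrite (proj2 (qmap_eq_iff _ x x' (ident_rel_equiv n A))); auto.
      now apply ident_rel_in with i.
    + exists (fun _ => True). split; [apply open_full | split; auto].
      intros z _ x Ax -> V' HV' V'y. apply NNPP; intros Hx. apply Hn. exists x, V'; auto.
  - exists V. repeat split; auto. intros i x Hi Ax Vx. now apply (H _ Vx i Hi x).
Qed.

(** Let [m] be the supremum of the times at which [f] meets the image of some [A i]. Such a time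
    close to [m] gives a point [z] linked to [x] by hypothesis, and its image lies in every
    neighbourhood of [f m], so [z] is linked to the point [w] over [f m]. Beyond [m] the path lifts
    by [linked_outside]. *)
Lemma linked_along {X : Type} (TX : topology X) n (A : nat -> X -> Prop)
    (U : quot (ident_rel n A) -> Prop) f u v x :
  (forall i, (i < n)%nat -> is_open TX (A i)) ->
  (forall i, (i < n)%nat -> path_connected_set TX (closure TX (A i))) ->
  cont (quotient_topology TX (ident_rel n A)) f -> u < v ->
  (forall r, u <= r <= v -> U (f r)) -> qmap (ident_rel n A) x = f u ->
  (forall r i z, u <= r <= v -> (i < n)%nat -> A i z -> qmap (ident_rel n A) z = f r ->
     linked TX (ident_rel n A) U x z) ->
  forall y, qmap (ident_rel n A) y = f v -> linked TX (ident_rel n A) U x y.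
Proof.
  intros HO HP Hf Huv HU Ex Hstar y Ey.
  pose proof (ident_rel_equiv n A) as HR.
  set (star := fun r => exists i z, (i < n)%nat /\ A i z /\ qmap (ident_rel n A) z = f r).
  destruct (classic (exists r, u <= r <= v /\ star r)) as [(r0 & Hr0 & Sr0)|Hn].
  2: { apply linked_outside with f u v; auto.
       intros r z Hr Ez i Hi Az. apply Hn. exists r; split; auto. exists i, z; auto. }
  destruct (completeness (fun r => u <= r <= v /\ star r)) as [m [Hub Hlub]].
  { exists v. intros r Hr; tauto. }
  { exists r0; auto. }
  assert (Hm : u <= m <= v).
  { split; [apply Rle_trans with r0; [tauto | apply Hub; auto]
           | apply Hlub; intros r Hr; tauto]. }
  destruct (quot_surj _ (f m)) as [w Ew].
  assert (Hxw : linked TX (ident_rel n A) U x w).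
  { destruct (nbhd_specialization TX n A (f m)) as (V & HV & Vm & HVs).
    destruct (Hf V HV m Vm) as (e & He & H).
    destruct (classic (exists r, u <= r <= v /\ star r /\ m - e < r)) as [(r & Hr & Sr & Hre)|Hn].
    - assert (r <= m) by (apply Hub; auto).
      destruct Sr as (i & z & Hi & Az & Ez).
      apply linked_trans with z; [now apply (Hstar r i)|]. apply linked_sym.
      apply linked_specialization with i; auto.
      + intros V' HV' V'w. apply (HVs i z); auto.
        * rewrite Ez. apply H. case_minmax.
        * now rewrite <- Ew.
      + rewrite Ew; auto.
      + rewrite Ez; auto.
    - exfalso. assert (m <= m - e); [|lra]. apply Hlub. intros r [Hr Sr].
      apply Rnot_lt_le; intros Hlt. apply Hn; eauto. }
  apply linked_trans with w; auto.
  destruct (Req_dec m v) as [->|Hne].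
  { apply linked_fiber; auto; [|rewrite Ew; auto].
    apply (qmap_eq_iff _ w y HR). congruence. }
  apply linked_outside with f m v; auto; [lra | intros; apply HU; lra |].
  (* A meeting after [m] contradicts the supremum. So does one at [m < v]: the union of the [A i] is
     open and saturated, so [f] would remain in its image slightly beyond [m]. *)
  intros r z Hr Ez i Hi Az.
  destruct (saturated_image_open TX (ident_rel n A) (fun z => exists i, (i < n)%nat /\ A i z) HR)
    as (V & HV & HVN).
  { apply open_of_nbhd. intros z' (j & Hj & Az'). exists (A j). repeat split; eauto. }
  { apply ident_rel_saturated. intros; eauto. }
  assert (Sr : star r) by (exists i, z; auto).
  assert (r <= m) by (apply Hub; split; auto; lra).
  assert (r = m) as -> by lra.
  destruct (Hf V HV m) as (e & He & H'). { rewrite <- Ez. apply HVN; eauto. }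
  set (r := Rmin v (m + e / 2)).
  assert (m < r <= v /\ r <= m + e / 2) by (unfold r; case_minmax).
  assert (r <= m); [|lra]. apply Hub. split; [lra|].
  destruct (quot_surj _ (f r)) as [z' Ez'].
  assert (Vr : V (f r)) by (apply H'; case_minmax).
  rewrite <- Ez' in Vr. apply HVN in Vr. destruct Vr as (j & Hj & Az').
  exists j, z'; auto.
Qed.

Lemma locally_linked_open {X : Type} (TX : topology X) n (A : nat -> X -> Prop) :
  (forall i, (i < n)%nat -> is_open TX (A i)) ->
  (forall i, (i < n)%nat -> path_connected_set TX (closure TX (A i))) ->
  locally_linked TX (ident_rel n A).
Proof.
  intros HO HP f t U Hf HU Ut.
  destruct (nbhd_specialization TX n A (f t)) as (V & HV & Vt & HVs).
  destruct (Hf _ (open_inter _ _ _ _ HU HV) t (conj Ut Vt)) as (e & He & H).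
  exists e; split; auto. intros s Hs x x' Ex Ex'.
  assert (Hstar : forall r i z, Rabs (r - t) < e -> (i < n)%nat -> A i z ->
            qmap (ident_rel n A) z = f r -> linked TX (ident_rel n A) U x z).
  { intros r i z Hr Hi Az Ez. apply linked_specialization with i; auto.
    - rewrite Ex. apply (HVs i z); auto. rewrite Ez. now apply H.
    - rewrite Ex; auto.
    - rewrite Ez. now apply H. }
  destruct (Rtotal_order t s) as [Hts|[<-|Hts]].
  - apply (linked_along TX n A U f t s); auto.
    + intros r Hr. apply H. case_minmax.
    + intros r i z Hr. apply (Hstar r). case_minmax.
  - apply linked_fiber; auto; [|rewrite Ex; auto].
    apply (qmap_eq_iff _ x x' (ident_rel_equiv n A)). congruence.
  (* [linked_along] starts at the left end of an interval, so for [s < t] the path is run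
     backwards. *)
  - apply (linked_along TX n A U (fun r => f (- r)) (- t) (- s)); auto using Ropp_lt_gt_contravar.
    + apply cont_lip with 1; auto; [lra | intros a b; case_minmax].
    + intros r Hr. apply H. case_minmax.
    + now rewrite Ropp_involutive.
    + intros r i z Hr. apply (Hstar (- r)). case_minmax.
    + now rewrite Ropp_involutive.
Qed.

Theorem theorem4p1 (X : Type) (TX : topology X) (n : nat) (A : nat -> X -> Prop) :
  condition_star TX n A ->
  simply_connected TX ->
  forall a : X, (exists i, (i < n)%nat /\ A i a) ->
  indiscrete (pi1_top (quotient_topology TX (ident_rel n A)) (qmap (ident_rel n A) a)).
Proof.
  intros Hstar HS a _. apply indiscrete_of_locally_linked; auto.
  destruct Hstar as [[_ HA]|(_ & HX & _ & HA & HD)].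
  - apply locally_linked_open; intros i Hi; now apply HA.
  - now apply locally_linked_disjoint.
Qed.
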